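(* Let $p \in (1,\infty)$ and let $\omega$ be a $p$-concave distortion function. Let $(X,d,q)$ be a bounded, separable, finite Nagata-dimensional pointed metric space. Then there exists $D<\infty$ such that $(X,\omega \circ d,q)$ stochastic biLipschitzly embeds into a bounded, separable, pointed ultrametric space with distortion $D$. Furthermore, if $X$ is infinite and if $X$ is compact or $\mathrm{LF}(X,\omega \circ d)$ is complemented in $\mathrm{LF}(X,\omega \circ d)^{**}$, then $\mathrm{LF}(X,\omega \circ d) \approx \ell^1$.
   Context: A distortion function is a continuous concave function $\omega:[0,\infty)\to[0,\infty)$ with $\omega(0)=0$ and $\omega(t)>0$ for $t>0$. Then $\omega\circ d$ is a metric inducing the same topology as $d$. $\omega$ is $p$-concave if $\omega^p$ is concave. A metric space $X$ has Nagata dimension $n\in\mathbb{N}=\{0,1,2,\dots\}$ with constant $\gamma<\infty$ if for every $s>0$ there is a cover $\mathcal{C}$ of $X$ such that $\mathrm{diam}(C)\le\gamma s$ for all $C\in\mathcal{C}$ and every $A\subseteq X$ with $\mathrm{diam}(A)\le s$ meets at most $n+1$ members of $\mathcal{C}$; $X$ is finite Nagata-dimensional if such $n,\gamma$ exist. A pointed metric space is a metric space with a distinguished basepoint. A random map $\phi=\{\phi_\theta:X\to Y\}_{\theta\in\Omega}$ between pointed metric spaces $(X,d_X,x_0)$, $(Y,d_Y,y_0)$ is a family of maps indexed by a probability space $(\Omega,\mathcal{F},\mathbb{P})$ such that: for every $x\in X$, $\theta\mapsto\phi_\theta(x)$ is measurable (Borel $\sigma$-algebra on $Y$); for every $x\in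 X$ there are a separable $S\subseteq Y$ and a $\mathbb{P}$-null set $N$ with $\phi_\theta(x)\in S$ for all $\theta\in\Omega\setminus N$; and $\phi_\theta(x_0)=y_0$ for almost every $\theta$. It is a stochastic biLipschitz embedding of distortion $D<\infty$ and scaling factor $s\in(0,\infty)$ if for all $x,y\in X$: $\mathbb{E}_\theta[d_Y(\phi_\theta(x),\phi_\theta(y))]\le sD\,d_X(x,y)$, and $d_Y(\phi_\theta(x),\phi_\theta(y))\ge s\,d_X(x,y)$ for almost every $\theta$. ''Embeds with distortion $D$'' means such an embedding exists for some $s$. An ultrametric space is a metric space with $d(u,w)\le\max\{d(u,v),d(v,w)\}$. For a pointed metric space $X$, $\mathrm{Lip}_0(X)$ is the Banach space of real Lipschitz functions vanishing at the basepoint, normed by the Lipschitz constant; $\mathrm{LF}(X)$ (written $\mathrm{LF}(X,d)$ to indicate the metric) is the closed linear span in $\mathrm{Lip}_0(X)^*$ of the evaluation functionals $\delta_x$. A Banach space $V$ is complemented in $V^{**}$ if there is a bounded linear $P:V^{**}\to V$ with $P\circ J=\mathrm{id}_V$, $J:V\to V^{**}$ the canonical embedding. $V\approx W$ means isomorphic real Banach spaces. $\ell^1=\ell^1(\mathbb{N})$. *)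

(* Defs.v *)
From HB Require Import structures.
From mathcomp Require Import all_boot all_order all_algebra.
From mathcomp Require Import all_classical all_reals all_analysis.
From mathcomp Require Import ring lra.

Set Implicit Arguments.
Unset Strict Implicit.
Unset Printing Implicit Defensive.

Import Order.TTheory GRing.Theory Num.Theory.
Import numFieldNormedType.Exports.

Local Open Scope classical_set_scope.
Local Open Scope card_scope.
Local Open Scope ring_scope.

Section distortion.
Context {R : realType}.

Definition concave_on (D : set R) (f : R -> R) :=
  @convex_function R R^o D (fun t => - f t).

(* Only the restriction of the underlying function to [0, +oo[ is meaningful. *)
Record distortion := Distortion {
  dfun :> R -> R ;
  dfun_continuous : {within `[0, +oo[, continuous dfun} ;
  dfun_concave : concave_on `[0, +oo[ dfun ;
  dfun0 : dfun 0 = 0 ;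
  dfun_gt0 : forall t, 0 < t -> 0 < dfun t }.

Definition p_concave (p : R) (w : distortion) :=
  concave_on `[0, +oo[ (fun t => w t `^ p).

Lemma concave_onP (D : set R) (f : R -> R) : concave_on D f <->
  forall a x y, 0 <= a <= 1 -> D x -> D y ->
    a * f x + (1 - a) * f y <= f (a * x + (1 - a) * y).
Proof.
split=> [cf a x y /andP[a0 a1] Dx Dy|cf t x y /set_mem Dx /set_mem Dy].
  have ai : Itv.spec (@Itv.num_sem R) (Itv.Real `[0%Z, 1%Z]) a.
    by rewrite /Itv.spec/= /Itv.num_sem/= in_itv/= a0 a1 ger0_real.
  have := cf (Itv.mk ai) x y (mem_set Dx) (mem_set Dy).
  by rewrite !convRE /= /unstable.onem; lra.
have := cf t%:num x y; rewrite ge0 le1 => /(_ isT Dx Dy).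
by rewrite !convRE /= /unstable.onem; lra.
Qed.

Variable w : distortion.

Lemma distortion_ge0 t : 0 <= t -> 0 <= w t.
Proof.
rewrite le_eqVlt => /orP[/eqP <-|]; first by rewrite dfun0.
by move/dfun_gt0/ltW.
Qed.

Let concave_w a x y : 0 <= a <= 1 -> 0 <= x -> 0 <= y ->
  a * w x + (1 - a) * w y <= w (a * x + (1 - a) * y).
Proof.
move=> a01 x0 y0; have /concave_onP := dfun_concave w.
by apply=> //=; rewrite in_itv/= andbT.
Qed.

Lemma distortion_nondecreasing s t : 0 <= s -> s <= t -> w s <= w t.
Proof.
move=> s0; rewrite le_eqVlt => /orP[/eqP -> //|st].
rewrite leNgt; apply/negP => wts.
have t0 : 0 < t by exact: le_lt_trans st.
have wt0 := dfun_gt0 w t0.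
have ws0 : 0 < w s by exact: lt_trans wts.
(* t = a s + (1 - a) u with a in ]w t / w s, 1[ *)
pose a := (w t / w s + 1) / 2.
have q1 : w t / w s < 1 by rewrite ltr_pdivrMr// mul1r.
have q0 : 0 < w t / w s by rewrite divr_gt0.
have a1 : 0 < 1 - a by rewrite /a; lra.
have a0 : 0 < a by rewrite /a; lra.
pose u := (t - a * s) / (1 - a).
have u0 : 0 <= u.
  rewrite divr_ge0 ?(ltW a1)// subr_ge0 (le_trans _ (ltW st))//.
  by rewrite ler_piMl//; lra.
have a01 : 0 <= a <= 1 by lra.
have := concave_w a01 s0 u0.
have -> : a * s + (1 - a) * u = t by rewrite /u; field; lra.
have wu := distortion_ge0 u0.
have : w t < a * w s by rewrite -ltr_pdivrMr// /a; lra.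
have : 0 <= (1 - a) * w u by rewrite mulr_ge0// ltW.
lra.
Qed.

Lemma distortion_subadditive s t : 0 <= s -> 0 <= t -> w (s + t) <= w s + w t.
Proof.
rewrite le_eqVlt => /orP[/eqP <-|s0]; first by rewrite add0r dfun0 add0r.
rewrite le_eqVlt => /orP[/eqP <-|t0]; first by rewrite addr0 dfun0 addr0.
have st0 : 0 < s + t by exact: addr_gt0.
have aux x y : 0 < x -> 0 < y -> x / (x + y) * w (x + y) <= w x.
  move=> x0 y0; have xy0 : 0 < x + y by exact: addr_gt0.
  have a01 : 0 <= x / (x + y) <= 1.
    by rewrite divr_ge0 ?(ltW x0) ?(ltW xy0)//= ler_pdivrMr// mul1r; lra.
  have := concave_w a01 (ltW xy0) (lexx 0).
  by rewrite dfun0 !mulr0 !addr0 divfK// gt_eqF.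
have Hs := aux _ _ s0 t0.
have := aux _ _ t0 s0; rewrite (addrC t s) => Ht.
have -> : w (s + t) = s / (s + t) * w (s + t) + t / (s + t) * w (s + t).
  by field; rewrite gt_eqF.
exact: lerD.
Qed.

End distortion.
Arguments distortion R : clear implicits.

(* The metric space (X, w o d). *)
Definition distorted (R : realType) (w : distortion R) (X : metricType R) : Type
  := X.

Section distorted_metric.
Context (R : realType) (w : distortion R) (X : metricType R).

Let wd (x y : distorted w X) : R := w (@mdist R X x y).

Let wd_refl x : wd x x = 0. Proof. by rewrite /wd mdistxx dfun0. Qed.

Let wd_positivity x y : wd x y = 0 -> x = y.
Proof.
move=> wxy; apply/(@mdist_positivity R X)/eqP; rewrite eq_le mdist_ge0 andbT.
by rewrite leNgt; apply/negP => /(dfun_gt0 w); rewrite -/(wd x y) wxy ltxx.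
Qed.

Let wd_sym x y : wd x y = wd y x. Proof. by rewrite /wd metric_sym. Qed.

Let wd_triangle y x z : wd x z <= wd x y + wd y z.
Proof.
apply: (le_trans _ (distortion_subadditive _ _ _)); rewrite ?mdist_ge0//.
by apply: distortion_nondecreasing; rewrite ?mdist_ge0// metric_triangle.
Qed.

HB.instance Definition _ := Choice.copy (distorted w X) X.
HB.instance Definition _ := isMetric.Build R (distorted w X)
  wd_refl wd_positivity wd_sym wd_triangle.

Lemma mdist_distorted (x y : X) :
  @mdist R (distorted w X) x y = w (@mdist R X x y).
Proof. by []. Qed.

End distorted_metric.

Section metric_notions.
Context {R : realType}.

(* diam set0 = -oo; the values below are only compared with upper bounds. *)
Definition diam (X : metricType R) (A : set X) : \bar R :=
  ereal_sup [set (mdist xy.1 xy.2)%:E | xy in A `*` A].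

Definition bounded_space (X : metricType R) := (diam [set: X] < +oo)%E.

Definition separable_set (T : topologicalType) (S : set T) :=
  exists D : set T, [/\ countable D, D `<=` S & S `<=` closure D].

Definition nagata_dim_with (X : metricType R) (n : nat) (gamma : R) :=
  forall s : R, 0 < s -> exists C : set (set X),
    [/\ \bigcup_(B in C) B = [set: X],
        forall B, C B -> (diam B <= (gamma * s)%:E)%E
      & forall A : set X, (diam A <= s%:E)%E ->
          [set B | C B /\ A `&` B !=set0] #<= `I_n.+1].

Definition finite_nagata_dim (X : metricType R) :=
  exists (n : nat) (gamma : R), nagata_dim_with X n gamma.

Definition ultrametric (X : metricType R) :=
  forall u v z : X, mdist u z <= Num.max (mdist u v) (mdist v z).

End metric_notions.

Section random_maps.
Context {R : realType} {X Y : metricType R}.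
Context {dO : measure_display} {Omega : measurableType dO}.
Implicit Types (P : probability Omega R) (phi : Omega -> X -> Y).

Record random_map P (x0 : X) (y0 : Y) phi : Prop := RandomMap {
  random_map_measurable : forall (x : X) (B : set Y),
    <<s [set U : set Y | open U] >> B -> measurable [set t | B (phi t x)] ;
  random_map_separable : forall x : X, exists2 S : set Y,
    separable_set S & {ae P, forall t, S (phi t x)} ;
  random_map_base : {ae P, forall t, phi t x0 = y0} }.

Record stoch_bilipschitz P phi (D s : R) : Prop := StochBilipschitz {
  stoch_bilipschitz_upper : forall x y : X,
    ('E_P[fun t => mdist (phi t x) (phi t y)] <= (s * D * mdist x y)%:E)%E ;
  stoch_bilipschitz_lower : forall x y : X,
    {ae P, forall t, s * mdist x y <= mdist (phi t x) (phi t y)} }.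

End random_maps.

Definition stoch_embeds {R : realType} (X Y : metricType R) (x0 : X) (y0 : Y)
    (D : R) :=
  exists (dO : measure_display) (Omega : measurableType dO)
         (P : probability Omega R) (phi : Omega -> X -> Y),
    random_map P x0 y0 phi /\
    exists2 s : R, 0 < s & stoch_bilipschitz P phi D s.

Section subspaces.
Context {R : realType}.

Definition is_subspace (V : lmodType R) (A : set V) :=
  A 0 /\ forall (a : R) (u v : V), A u -> A v -> A (a *: u + v).

Definition subspace_pred (V : lmodType R) (A : set V) (hA : is_subspace A) :
  {pred V} := mem A.

Record subspace_of (V : lmodType R) (A : set V) (hA : is_subspace A) :=
  SubspaceOf { subspace_val : V ; _ : subspace_val \in subspace_pred hA }.

Section instances.
Context (V : lmodType R) (A : set V) (hA : is_subspace A).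

Let A_closed : submod_closed (subspace_pred hA).
Proof.
move: (hA) => [A0 Al]; split; first exact/mem_set.
by move=> a u v /set_mem Au /set_mem Av; apply/mem_set/Al.
Qed.

HB.instance Definition _ :=
  GRing.isSubmodClosed.Build R V (subspace_pred hA) A_closed.
HB.instance Definition _ := [isSub of subspace_of hA for @subspace_val V A hA].
HB.instance Definition _ := [Choice of subspace_of hA by <:].
HB.instance Definition _ := [SubChoice_isSubLmodule of subspace_of hA by <:].
End instances.

End subspaces.

(* The least k >= 0 such that F i <= k * G i for all i. *)
Section best_constant.
Context {R : realType} {I : Type}.
Implicit Types F G : I -> R.

Definition best_constant F G : R :=
  inf [set k | 0 <= k /\ forall i, F i <= k * G i].

Lemma best_constant_le F G k : 0 <= k -> (forall i, F i <= k * G i) ->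
  best_constant F G <= k.
Proof. by move=> k0 Fk; apply: ge_inf; [exists 0 => ? []|split]. Qed.

Lemma best_constant_ge0 F G : 0 <= best_constant F G.
Proof.
rewrite /best_constant; set S := [set k | _].
have [->|/set0P S0] := eqVneq S set0; first by rewrite inf0.
by apply: lb_le_inf => // k [].
Qed.

Lemma best_constantP F G : (forall i, 0 <= G i) ->
  (exists k, forall i, F i <= k * G i) ->
  forall i, F i <= best_constant F G * G i.
Proof.
move=> G0 [k Fk] i.
have S0 : [set k | 0 <= k /\ forall i, F i <= k * G i] !=set0.
  exists `|k|; split=> // j; apply: (le_trans (Fk j)).
  by rewrite ler_wpM2r// ler_norm.
have := G0 i; rewrite le_eqVlt => /orP[/eqP Gi|Gi].
  by have := Fk i; rewrite -Gi !mulr0.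
rewrite -ler_pdivrMr//; apply: lb_le_inf => // l [_ Fl].
by rewrite ler_pdivrMr.
Qed.

End best_constant.

Section Lip0.
Context {R : realType} (X : metricType R) (q : X).

Definition lipschitz0 : set (X -> R^o) := [set f | f q = 0 /\
  exists k : R, forall x y, `|f x - f y| <= k * mdist x y].

Lemma lipschitz0_subspace : is_subspace lipschitz0.
Proof.
split=> [|a f g [fq [k fk]] [gq [l gl]]].
  by split=> //; exists 0 => x y; rewrite subrr normr0 mul0r.
split; first by rewrite -[LHS]/(a *: f q + g q) fq gq scaler0 addr0.
exists (`|a| * k + l) => x y.
have -> : (a *: f + g) x - (a *: f + g) y = a * (f x - f y) + (g x - g y).
  rewrite -[LHS]/((a * f x + g x) - (a * f y + g y)); ring.
by rewrite (le_trans (ler_normD _ _))// normrM mulrDl -mulrA lerD// ler_wpM2l.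
Qed.

Definition Lip0 : Type := subspace_of lipschitz0_subspace.
HB.instance Definition _ := GRing.Lmodule.copy Lip0
  (subspace_of lipschitz0_subspace).

Definition lip0_fun (f : Lip0) : X -> R := subspace_val f.

Definition lip_norm (f : Lip0) : R :=
  best_constant (fun xy : X * X => `|lip0_fun f xy.1 - lip0_fun f xy.2|)
                (fun xy => mdist xy.1 xy.2).

Lemma lip0_fun_base f : lip0_fun f q = 0.
Proof. by case: f => f /= /set_mem[]. Qed.

Lemma lip0_funP a f g x :
  lip0_fun (a *: f + g) x = a * lip0_fun f x + lip0_fun g x.
Proof. by []. Qed.

Lemma lip_normP f x y :
  `|lip0_fun f x - lip0_fun f y| <= lip_norm f * mdist x y.
Proof.
apply: (@best_constantP _ _ (fun xy : X * X => `|_ xy.1 - _ xy.2|)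
  (fun xy => mdist xy.1 xy.2) _ _ (x, y)) => [[? ?]|]; first exact: mdist_ge0.
by case: f => f /= /set_mem[_ [k fk]]; exists k => -[? ?]; exact: fk.
Qed.

Lemma lip_norm_le f k : 0 <= k ->
  (forall x y, `|lip0_fun f x - lip0_fun f y| <= k * mdist x y) ->
  lip_norm f <= k.
Proof. by move=> k0 fk; apply: best_constant_le => // -[x y]; exact: fk. Qed.

Let lip_normD f g : lip_norm (f + g) <= lip_norm f + lip_norm g.
Proof.
apply: lip_norm_le => [|x y]; first by rewrite addr_ge0 ?best_constant_ge0.
have -> : lip0_fun (f + g) x - lip0_fun (f + g) y =
  (lip0_fun f x - lip0_fun f y) + (lip0_fun g x - lip0_fun g y).
  by rewrite -[f]scale1r !lip0_funP !scale1r; ring.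
by rewrite (le_trans (ler_normD _ _))// mulrDl lerD// lip_normP.
Qed.

Let lip_normZ_le a f : lip_norm (a *: f) <= `|a| * lip_norm f.
Proof.
apply: lip_norm_le => [|x y]; first by rewrite mulr_ge0 ?best_constant_ge0.
have -> : lip0_fun (a *: f) x - lip0_fun (a *: f) y =
  a * (lip0_fun f x - lip0_fun f y).
  by rewrite -[a *: f]addr0 !lip0_funP; ring.
by rewrite normrM -mulrA ler_wpM2l// lip_normP.
Qed.

Let lip_normZ a f : lip_norm (a *: f) = `|a| * lip_norm f.
Proof.
apply/eqP; rewrite eq_le lip_normZ_le/=.
have [->|a0] := eqVneq a 0; first by rewrite normr0 mul0r best_constant_ge0.
have := lip_normZ_le a^-1 (a *: f); rewrite scalerA mulVf// scale1r normfV.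
by rewrite mulrC ler_pdivlMr ?normr_gt0// mulrC.
Qed.

Let lip_norm_eq0 f : lip_norm f = 0 -> f = 0.
Proof.
move=> f0; apply/val_inj/funext => x /=.
have := lip_normP f x q; rewrite f0 mul0r lip0_fun_base subr0 normr_le0.
by move/eqP.
Qed.

HB.instance Definition _ := @Lmodule_isNormed.Build R Lip0 lip_norm
  lip_normD lip_normZ lip_norm_eq0.

End Lip0.

Section dual.
Context {R : realType} (V : normedModType R).

Definition continuous_functional : set (V -> R^o) :=
  [set f | linear f /\ continuous f].

Lemma continuous_functional_subspace : is_subspace continuous_functional.
Proof.
split=> [|a f g [lf cf] [lg cg]].
  by split=> [b u v|]; [rewrite scaler0 addr0|exact: cst_continuous].
split=> [b u v|v].
  by rewrite !fctE lf lg !scalerDr !scalerA (mulrC a b) !addrA; congr (_ + _);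
    rewrite -!addrA; congr (_ + _); rewrite addrC.
by apply: cvgD; [apply: cvgZr; exact: cf|exact: cg].
Qed.

Definition dual : Type := subspace_of continuous_functional_subspace.
HB.instance Definition _ := GRing.Lmodule.copy dual
  (subspace_of continuous_functional_subspace).

Definition dual_fun (f : dual) : V -> R := subspace_val f.

Definition op_norm (f : dual) : R :=
  best_constant (fun v => `|dual_fun f v|) (fun v => `|v|).

Lemma dual_linear (f : dual) a u v :
  dual_fun f (a *: u + v) = a * dual_fun f u + dual_fun f v.
Proof. by case: f => f /= /set_mem[lf _]; rewrite /dual_fun /= lf. Qed.

Lemma dual_funP a f g v :
  dual_fun (a *: f + g) v = a * dual_fun f v + dual_fun g v.
Proof. by []. Qed.

Lemma bounded_functional (f : V -> R^o) : linear f -> continuous f ->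
  exists k : R, forall v, `|f v| <= k * `|v|.
Proof.
move=> lf cf.
pose F : {linear V -> R^o} := HB.pack f (GRing.isLinear.Build _ _ _ _ f lf).
have /linear_boundedP : bounded_near F (nbhs 0).
  by apply/linear_bounded_continuous.
by move=> [M [_ FM]]; exists (M + 1) => v; apply: FM; rewrite ltrDl.
Qed.

Lemma functional_bounded (f : V -> R^o) : linear f ->
  (exists k : R, forall v, `|f v| <= k * `|v|) -> continuous f.
Proof.
move=> lf [k fk].
pose F : {linear V -> R^o} := HB.pack f (GRing.isLinear.Build _ _ _ _ f lf).
have : bounded_near F (nbhs 0).
  apply/linear_boundedP; exists k; split; first exact: num_real.
  by move=> r kr v; rewrite (le_trans (fk v))// ler_wpM2r// ltW.
by move/linear_bounded_continuous.
Qed.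

Lemma op_normP f v : `|dual_fun f v| <= op_norm f * `|v|.
Proof.
apply: (@best_constantP _ _ (fun v => `|dual_fun f v|)) => //.
by case: f => f /= /set_mem[]; exact: bounded_functional.
Qed.

Lemma op_norm_le f k : 0 <= k -> (forall v, `|dual_fun f v| <= k * `|v|) ->
  op_norm f <= k.
Proof. exact: best_constant_le. Qed.

Let op_normD f g : op_norm (f + g) <= op_norm f + op_norm g.
Proof.
apply: op_norm_le => [|v]; first by rewrite addr_ge0 ?best_constant_ge0.
have -> : dual_fun (f + g) v = dual_fun f v + dual_fun g v by [].
by rewrite (le_trans (ler_normD _ _))// mulrDl lerD// op_normP.
Qed.

Let op_normZ_le a f : op_norm (a *: f) <= `|a| * op_norm f.
Proof.
apply: op_norm_le => [|v]; first by rewrite mulr_ge0 ?best_constant_ge0.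
have -> : dual_fun (a *: f) v = a * dual_fun f v by [].
by rewrite normrM -mulrA ler_wpM2l// op_normP.
Qed.

Let op_normZ a f : op_norm (a *: f) = `|a| * op_norm f.
Proof.
apply/eqP; rewrite eq_le op_normZ_le/=.
have [->|a0] := eqVneq a 0; first by rewrite normr0 mul0r best_constant_ge0.
have := op_normZ_le a^-1 (a *: f); rewrite scalerA mulVf// scale1r normfV.
by rewrite mulrC ler_pdivlMr ?normr_gt0// mulrC.
Qed.

Let op_norm_eq0 f : op_norm f = 0 -> f = 0.
Proof.
move=> f0; apply/val_inj/funext => v /=.
by have := op_normP f v; rewrite f0 mul0r normr_le0 => /eqP.
Qed.

HB.instance Definition _ := @Lmodule_isNormed.Build R dual op_norm
  op_normD op_normZ op_norm_eq0.

Definition mk_dual (f : V -> R) (lf : linear (f : V -> R^o))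
  (bf : exists k : R, forall v, `|f v| <= k * `|v|) : dual :=
  @SubspaceOf R (V -> R^o) _ continuous_functional_subspace f
    (mem_set (conj lf (functional_bounded lf bf))).

End dual.

Section bidual.
Context {R : realType} (V : normedModType R).

Let J_linear (v : V) : linear ((fun f : dual V => dual_fun f v) : _ -> R^o).
Proof. by []. Qed.

Let J_bounded (v : V) :
  exists k : R, forall f : dual V, `|dual_fun f v| <= k * `|f|.
Proof. by exists `|v| => f; rewrite mulrC; exact: op_normP. Qed.

Definition bidual_embedding (v : V) : dual (dual V) :=
  mk_dual (@J_linear v) (J_bounded v).

Definition complemented_in_bidual :=
  exists P : {linear dual (dual V) -> V},
    continuous P /\ forall v, P (bidual_embedding v) = v.

End bidual.

Definition isomorphic {R : realType} (V W : normedModType R) :=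
  exists (T : {linear V -> W}) (S : {linear W -> V}),
    [/\ cancel T S, cancel S T, continuous T & continuous S].

Section lipschitz_free.
Context {R : realType} (X : metricType R) (q : X).

Let delta_linear (x : X) : linear ((fun f : Lip0 q => lip0_fun f x) : _ -> R^o).
Proof. by []. Qed.

Let delta_bounded (x : X) :
  exists k : R, forall f : Lip0 q, `|lip0_fun f x| <= k * `|f|.
Proof.
exists (mdist x q) => f; rewrite mulrC.
by have := lip_normP f x q; rewrite lip0_fun_base subr0.
Qed.

Definition delta (x : X) : dual (Lip0 q) :=
  mk_dual (@delta_linear x) (delta_bounded x).

Definition linear_span (V : lmodType R) (A : set V) : set V :=
  [set v | exists (n : nat) (a : 'I_n -> R) (u : 'I_n -> V),
    (forall i, A (u i)) /\ v = \sum_(i < n) a i *: u i].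

Definition lip_free_set : set (dual (Lip0 q)) :=
  closure (linear_span (range delta)).

Lemma linear_span_subspace (V : lmodType R) (A : set V) :
  is_subspace (linear_span A).
Proof.
split=> [|c v w [n [a [u [Au ->]]]] [m [b [z [Az ->]]]]].
  exists 0%N, (fun=> 0), (fun=> 0); split; last by rewrite big_ord0.
  by case.
exists (n + m)%N,
  (fun i => match fintype.split i with inl j => c * a j | inr k => b k end),
  (fun i => match fintype.split i with inl j => u j | inr k => z k end).
split=> [i|]; first by case: (fintype.split i).
rewrite big_split_ord/= scaler_sumr; congr (_ + _); apply: eq_bigr => i _.
  by rewrite (unsplitK (inl i)) scalerA.
by rewrite (unsplitK (inr i)).
Qed.

Lemma closure_subspace (V : normedModType R) (A : set V) :
  is_subspace A -> is_subspace (closure A).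
Proof.
move=> [A0 Al]; split=> [|a u v]; first exact: subset_closure.
move=> clu clv B.
have : (fun z : V * V => a *: z.1 + z.2) @ (nbhs u, nbhs v) --> a *: u + v.
  apply: cvgD; last exact: cvg_snd.
  by apply: cvgZr; exact: cvg_fst.
move=> /[apply] -[[U W]/= [Uu Wv] UWB].
have [x [Ax Ux]] := clu _ Uu; have [y [Ay Wy]] := clv _ Wv.
by exists (a *: x + y); split; [exact: Al|exact: (UWB (x, y))].
Qed.

Definition lip_free_subspace : is_subspace lip_free_set :=
  closure_subspace (linear_span_subspace _).

Definition LF : Type := subspace_of lip_free_subspace.
HB.instance Definition _ := GRing.Lmodule.copy LF
  (subspace_of lip_free_subspace).

Definition LF_norm (m : LF) : R := `|subspace_val m : dual (Lip0 q)|.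

Let LF_normD m n : LF_norm (m + n) <= LF_norm m + LF_norm n.
Proof. exact: ler_normD. Qed.

Let LF_normZ a m : LF_norm (a *: m) = `|a| * LF_norm m.
Proof. exact: normrZ. Qed.

Let LF_norm_eq0 m : LF_norm m = 0 -> m = 0.
Proof. by move=> /normr0_eq0 m0; exact/val_inj. Qed.

HB.instance Definition _ := @Lmodule_isNormed.Build R LF LF_norm
  LF_normD LF_normZ LF_norm_eq0.

End lipschitz_free.

Section ell1.
Context (R : realType).

Definition abs_summable : set (nat -> R^o) :=
  [set a | cvgn [series `|(a : R^o ^nat) n|]_n].

Let abs_summableD (c : R) (a b : nat -> R^o) : abs_summable a ->
  abs_summable b ->
  cvgn (`|c| *: [series `|a n|]_n + [series `|b n|]_n : R^o ^nat).
Proof. by move=> ca cb; apply: is_cvgD => //; exact: is_cvgZr. Qed.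

Let series_le (c : R) (a b : nat -> R^o) n :
  [series `|(c *: a + b) n|]_n n <=
  (`|c| *: [series `|a n|]_n + [series `|b n|]_n : R^o ^nat) n.
Proof.
rewrite !fctE /series/= /GRing.scale/= mulr_sumr -big_split/=.
by apply: ler_sum => i _; rewrite (le_trans (ler_normD _ _))// normrM.
Qed.

Lemma abs_summable_subspace : is_subspace abs_summable.
Proof.
split=> [|c a b sa sb].
  rewrite /abs_summable/=.
  rewrite (_ : [series _]_n = cst 0); first exact: is_cvg_cst.
  by apply/funext => n; rewrite /series/= big1// => i _; rewrite normr0.
have sab := @abs_summableD c _ _ sa sb.
apply: nondecreasing_is_cvgn.
  by apply: nondecreasing_series => n _ _; exact: normr_ge0.
have /cvg_seq_bounded/bounded_fun_has_ubound[M ubM] := sab.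
exists M => _ [n _ <-]; apply: le_trans (series_le c a b n) _.
by apply: ubM; exists n.
Qed.

Definition ell1 : Type := subspace_of abs_summable_subspace.
HB.instance Definition _ := GRing.Lmodule.copy ell1
  (subspace_of abs_summable_subspace).

Definition ell1_seq (a : ell1) : nat -> R := subspace_val a.

Definition ell1_norm (a : ell1) : R := limn [series `|ell1_seq a n|]_n.

Let ell1_cvg a : cvgn [series `|ell1_seq a n|]_n.
Proof. by case: a => a /= /set_mem. Qed.

Let ell1_norm_le c a b :
  ell1_norm (c *: a + b) <= `|c| * ell1_norm a + ell1_norm b.
Proof.
have sa := @ell1_cvg a; have sb := @ell1_cvg b.
have -> : `|c| * ell1_norm a + ell1_norm b =
   limn (`|c| *: [series `|ell1_seq a n|]_n +
         [series `|ell1_seq b n|]_n : R^o ^nat).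
  by rewrite limD// ?limZr//; apply: cvgZr; exact: sa.
apply: ler_lim; [exact: (@ell1_cvg (c *: a + b))|exact: abs_summableD|].
by apply: nearW => n; exact: series_le.
Qed.

Let series_le_norm a n : [series `|ell1_seq a n|]_n n <= ell1_norm a.
Proof.
have nd : nondecreasing_seq [series `|ell1_seq a n|]_n.
  by apply: nondecreasing_series => ? _ _; exact: normr_ge0.
exact: (nondecreasing_cvgn_le nd (@ell1_cvg a)).
Qed.

Let ell1_norm_ge0 a : 0 <= ell1_norm a.
Proof. by have := series_le_norm a 0; rewrite /series/= big_geq. Qed.

Let ell1_norm0 : ell1_norm 0 = 0.
Proof.
rewrite /ell1_norm (_ : [series _]_n = cst 0) ?lim_cst//.
by apply/funext => n; rewrite /series/= big1// => i _; rewrite normr0.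
Qed.

Let ell1_normD a b : ell1_norm (a + b) <= ell1_norm a + ell1_norm b.
Proof. by have := ell1_norm_le 1 a b; rewrite scale1r normr1 mul1r. Qed.

Let ell1_normZ_le c a : ell1_norm (c *: a) <= `|c| * ell1_norm a.
Proof. by have := ell1_norm_le c a 0; rewrite ell1_norm0 !addr0. Qed.

Let ell1_normZ c a : ell1_norm (c *: a) = `|c| * ell1_norm a.
Proof.
apply/eqP; rewrite eq_le ell1_normZ_le/=.
have [->|c0] := eqVneq c 0; first by rewrite normr0 mul0r ell1_norm_ge0.
have := ell1_normZ_le c^-1 (c *: a); rewrite scalerA mulVf// scale1r normfV.
by rewrite mulrC ler_pdivlMr ?normr_gt0// mulrC.
Qed.

Let ell1_norm_eq0 a : ell1_norm a = 0 -> a = 0.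
Proof.
move=> a0; apply/val_inj/funext => n /=.
have := series_le_norm a n.+1; rewrite a0 /series/= big_nat_recr//= => an.
apply/eqP; rewrite -normr_le0 (le_trans _ an)// lerDr.
by apply: sumr_ge0 => i _; exact: normr_ge0.
Qed.

HB.instance Definition _ := @Lmodule_isNormed.Build R ell1 ell1_norm
  ell1_normD ell1_normZ ell1_norm_eq0.

End ell1.

(* Main.v *)
From HB Require Import structures.
Require Import Defs.
From mathcomp Require Import all_boot all_order all_algebra.
From mathcomp Require Import all_classical all_reals all_analysis.
From mathcomp Require Import measurable_realfun.
From mathcomp Require Import ring lra.

Set Implicit Arguments.
Unset Strict Implicit.
Unset Printing Implicit Defensive.

Import Order.TTheory GRing.Theory Num.Theory.
Import numFieldNormedType.Exports.

Local Open Scope classical_set_scope.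
Local Open Scope ring_scope.

(** Choose scales [s k] with [w (s k) = w0 / 2 ^+ k]. For every distance [r] the
    sum over [k] of [w (s k) * min (1, r / s k)] is at most a constant times
    [w r] ([sum_scales_le]): where [w (s k) <= w r] the terms decrease
    geometrically by the choice of the scales, and elsewhere [p]-concavity with
    [p > 1] makes [w (s k) / s k] geometric as well. At each scale a Nagata cover
    provides countably many bump functions [psi k i] with values in [[0, 1]],
    Lipschitz constant [2 / s k], supports of diameter [O(s k)], boundedly many
    of them nonzero at each point, and one of them equal to [1] there
    ([nagata_bump_family], [multiscale_exists]). Both halves of the theorem are
    read off from these functions, through the same estimate of the sum.

    For the random embedding, draw one threshold [t] uniformly in [[0, 1]] and
    let the label of [x] at level [k] be the least [i] with [t <= psi k i x].
    The word of the labels of [x] lives in the ultrametric space of sequences of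
    integers, at distance [1 / 2 ^+ k] when [k] is the first difference. Two
    points receive different labels at level [k] with probability
    [O(min (1, d x y / s k))], so the expected distance of their words is
    [O(w (d x y))] ([expected_word_dist_le]); equal labels at level [k] force
    [d x y = O(s k)], whence a lower bound for every threshold
    ([random_word_lower]).

    For the free space, the parts [phi k i] of the bumps that exceed the
    previous ones form a partition of unity, and with points [z k i] near
    the supports every Lipschitz function [f] is the limit of
    [S k f = \sum_i f (z k i) * phi k i]. The telescoping sum
    [f - f (z 0 0) = \sum_k (S k.+1 f - S k f)], that is
    [\sum_(k, i, j) phi k.+1 i * phi k j * (f (z k.+1 i) - f (z k j))],
    dualizes to a factorization of the identity of the free space through l1,
    with coordinates [w (s k) * phi k.+1 i * phi k j] and vectors
    [(delta (z k.+1 i) - delta (z k j)) / w (s k)]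
    ([free_space_factorization]). Conversely an infinite bounded metric space
    carries a sequence of disjoint bumps with biorthogonal molecules, so its free
    space contains a complemented copy of l1 ([bump_sequence_exists],
    [bump_sequence_complemented]). The free space and l1, each of them
    complemented in the other, are isomorphic by Pelczynski's decomposition
    method ([complemented_ell1_isomorphic]). *)

(** * Sums over pairs of integers *)

Lemma nat_pairing_exists :
  exists dc : (nat -> nat * nat) * (nat * nat -> nat),
    cancel dc.1 dc.2 /\ cancel dc.2 dc.1.
Proof.
have /card_set_bijP[f bf] := card_nat2.
have [g fg gf] : bijective f by rewrite -setTT_bijective.
by exists (g, f).
Qed.

Definition unpair : nat -> nat * nat := (sval (cid nat_pairing_exists)).1.
Definition pair_code : nat * nat -> nat := (sval (cid nat_pairing_exists)).2.

Lemma unpairK : cancel unpair pair_code.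
Proof. by rewrite /unpair /pair_code; case: cid => -[? ?] /= []. Qed.

Lemma pair_codeK : cancel pair_code unpair.
Proof. by rewrite /unpair /pair_code; case: cid => -[? ?] /= []. Qed.

Section pairing_sums.
Context {R : realType}.

Lemma ler_sum_uniq_sub (T : eqType) (s r : seq T) (g : T -> R) :
  (forall x, 0 <= g x) -> uniq s -> uniq r -> {subset s <= r} ->
  \sum_(x <- s) g x <= \sum_(x <- r) g x.
Proof.
move=> g0 us ur sr; have pe : perm_eq s [seq x <- r | x \in s].
  apply: uniq_perm => //; first exact: filter_uniq.
  by move=> x; rewrite mem_filter; case: (boolP (x \in s)) => // /sr ->.
rewrite (perm_big _ pe) big_filter big_mkcond/=.
by apply: ler_sum => x _; case: ifP.
Qed.

Definition nat_box (K L : nat) : seq (nat * nat) :=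
  [seq (k, l) | k <- iota 0 K, l <- iota 0 L].

Lemma nat_box_uniq K L : uniq (nat_box K L).
Proof. by apply: allpairs_uniq; rewrite ?iota_uniq// => -[? ?] [? ?]. Qed.

Lemma mem_nat_box K L p : (p \in nat_box K L) = (p.1 < K)%N && (p.2 < L)%N.
Proof.
case: p => k l /=; apply/allpairsP/andP => [[[a b] /= [+ + [-> ->]]]|[kK lL]].
  by rewrite !mem_iota.
by exists (k, l); rewrite !mem_iota.
Qed.

Lemma sum_nat_box (g : nat * nat -> R) K L :
  \sum_(p <- nat_box K L) g p = \sum_(k < K) \sum_(l < L) g (k : nat, l : nat).
Proof.
rewrite big_allpairs -(big_mkord predT (fun k => \sum_(l < L) g (k, l : nat))).
rewrite /index_iota subn0; apply: eq_bigr => k _.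
by rewrite -(big_mkord predT (fun l => g (k, l))) /index_iota subn0.
Qed.

Lemma unpair_iota_uniq N : uniq [seq unpair c | c <- iota 0 N].
Proof. by rewrite map_inj_uniq ?iota_uniq//; exact: can_inj unpairK. Qed.

Lemma sum_unpair_iota (g : nat * nat -> R) N :
  \sum_(p <- [seq unpair c | c <- iota 0 N]) g p = \sum_(c < N) g (unpair c).
Proof.
rewrite big_map -(big_mkord predT (fun c => g (unpair c))).
by rewrite /index_iota subn0.
Qed.

Lemma nat_seq_bounded (s : seq nat) : exists K, forall k, k \in s -> (k < K)%N.
Proof.
elim: s => [|a s [K sK]]; first by exists 0%N.
exists (maxn a.+1 K) => k; rewrite inE leq_max => /orP[/eqP ->|/sK ->].
  by rewrite ltnSn.
by rewrite orbT.
Qed.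

Lemma unpair_iota_box N :
  exists K, {subset [seq unpair c | c <- iota 0 N] <= nat_box K K}.
Proof.
set s := [seq _ | _ <- _].
have [K1 K1P] := nat_seq_bounded (map fst s).
have [K2 K2P] := nat_seq_bounded (map snd s).
exists (maxn K1 K2) => p ps; rewrite mem_nat_box !leq_max.
by rewrite (K1P _ (map_f _ ps)) (K2P _ (map_f _ ps)) orbT.
Qed.

Lemma box_unpair_iota K L :
  exists N0, forall N, (N0 <= N)%N ->
    {subset nat_box K L <= [seq unpair c | c <- iota 0 N]}.
Proof.
have [N0 N0P] := nat_seq_bounded (map pair_code (nat_box K L)).
exists N0 => N N0N p pb; apply/mapP; exists (pair_code p).
  by rewrite mem_iota/= (leq_trans _ N0N)// N0P// map_f.
by rewrite pair_codeK.
Qed.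

Lemma sum_unpair_le (g : nat -> nat -> R) (C : R) :
  (forall k l, 0 <= g k l) ->
  (forall K L, \sum_(k < K) \sum_(l < L) g k l <= C) ->
  forall N, \sum_(c < N) g (unpair c).1 (unpair c).2 <= C.
Proof.
move=> g0 gC N; rewrite -(sum_unpair_iota (fun p => g p.1 p.2)).
have [K NK] := unpair_iota_box N.
have g0' p : 0 <= g p.1 p.2 by exact: g0.
apply: (le_trans (ler_sum_uniq_sub g0' (unpair_iota_uniq N)
  (nat_box_uniq K K) NK)).
by rewrite sum_nat_box.
Qed.

Lemma sum_unpair_split (t : nat -> nat -> R) K L :
  exists N0, forall N, (N0 <= N)%N ->
    \sum_(c < N) t (unpair c).1 (unpair c).2 =
    \sum_(k < K) \sum_(l < L) t k l +
    \sum_(c < N) (if ((unpair c).1 < K)%N && ((unpair c).2 < L)%N then 0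
                  else t (unpair c).1 (unpair c).2).
Proof.
have [N0 N0P] := box_unpair_iota K L.
exists N0 => N /N0P sub.
rewrite -(sum_nat_box (fun p => t p.1 p.2)).
rewrite -(sum_unpair_iota (fun p => if (p.1 < K)%N && (p.2 < L)%N then 0
                                    else t p.1 p.2)).
rewrite -(sum_unpair_iota (fun p => t p.1 p.2)).
set s := [seq unpair _ | _ <- _].
have pe : perm_eq (nat_box K L) [seq p <- s | p \in nat_box K L].
  apply: uniq_perm; first exact: nat_box_uniq.
    by rewrite filter_uniq// unpair_iota_uniq.
  by move=> p; rewrite mem_filter; case: (boolP (p \in nat_box K L)) => // /sub.
rewrite (perm_big _ pe) big_filter [X in X + _]big_mkcond/= -big_split/=.
apply: eq_bigr => p _; rewrite mem_nat_box.
by case: ifP => _; rewrite ?addr0 ?add0r.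
Qed.

Lemma sum_unpair_finite (t : nat -> nat -> R) I :
  (forall i j, t i j != 0 -> (i < I)%N && (j < I)%N) ->
  exists N0, forall N, (N0 <= N)%N ->
    \sum_(c < N) t (unpair c).1 (unpair c).2 = \sum_(i < I) \sum_(j < I) t i j.
Proof.
move=> tI; have [N0 N0P] := sum_unpair_split t I I.
exists N0 => N /N0P ->; rewrite [X in _ + X]big1 ?addr0// => c _.
by case: ifPn => // /negP h; apply/eqP/negPn/negP => /tI/h.
Qed.

Lemma sum_geometric_le (C : R) K : 0 <= C ->
  \sum_(k < K) C / 2 ^+ k <= 2 * C - 2 * C / 2 ^+ K.
Proof.
move=> C0; elim: K => [|K IH]; first by rewrite big_ord0 expr0 divr1 subrr.
rewrite big_ord_recr/=; apply: (le_trans (lerD IH (lexx _))).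
rewrite exprS; set z : R := _ ^+ K; have z0 : z != 0 by rewrite expf_neq0.
rewrite le_eqVlt; apply/orP; left; apply/eqP; field.
by rewrite z0.
Qed.

(** The rows before [K], being finitely supported, are exhausted by finitely many
    codes, and the other rows contribute at most the tail of a geometric
    series. *)
Lemma sum_unpair_approx (t : nat -> nat -> R) (T : nat -> R) (C : R) K :
  0 <= C ->
  (forall k L, \sum_(l < L) `|t k l| <= C / 2 ^+ k) ->
  (forall k, exists L0, forall L, (L0 <= L)%N -> \sum_(l < L) t k l = T k) ->
  exists N0, forall N, (N0 <= N)%N ->
    `|\sum_(c < N) t (unpair c).1 (unpair c).2 - \sum_(k < K) T k|
      <= 2 * C / 2 ^+ K.
Proof.
move=> C0 tC tT.
have [L0 L0P] := choice tT.
have [L LP] := nat_seq_bounded (map L0 (iota 0 K)).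
have LT k : (k < K)%N -> (L0 k <= L)%N.
  by move=> kK; rewrite ltnW// LP// map_f// mem_iota.
have [N0 N0P] := sum_unpair_split t K L.
exists N0 => N /N0P ->.
have -> : \sum_(k < K) \sum_(l < L) t k l = \sum_(k < K) T k.
  by apply: eq_bigr => k _; exact/L0P/LT.
rewrite addrAC subrr add0r.
pose g k l := if (k < K)%N && (l < L)%N then 0 else `|t k l|.
apply: (le_trans (ler_norm_sum _ _ _)).
have -> : \sum_(c < N) `|if ((unpair c).1 < K)%N && ((unpair c).2 < L)%N then 0
      else t (unpair c).1 (unpair c).2| =
    \sum_(c < N) g (unpair c).1 (unpair c).2.
  by apply: eq_bigr => c _; rewrite /g; case: ifP; rewrite ?normr0.
apply: sum_unpair_le => [k l|M L'].
  by rewrite /g; case: ifP.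
have t0 k l : (k < K)%N -> (L <= l)%N -> t k l = 0.
  move=> kK Ll; have L0l := leq_trans (LT _ kK) Ll.
  have := L0P k l.+1 (leq_trans L0l (leqnSn _)).
  rewrite big_ord_recr/= (L0P k l L0l) => /eqP.
  by rewrite -subr_eq0 addrAC subrr add0r => /eqP.
have row k : \sum_(l < L') g k l <= (if (k < K)%N then 0 else C / 2 ^+ k).
  rewrite /g; case: ifPn => kK /=; last exact: tC.
  rewrite big1// => l _; case: ifPn => //; rewrite -leqNgt => Ll.
  by rewrite t0 ?normr0.
apply: (@le_trans _ _ (\sum_(k < M) if (k < K)%N then 0 else C / 2 ^+ k)).
  by apply: ler_sum => k _; exact: row.
have e0 n : 0 <= C / 2 ^+ n by rewrite divr_ge0// exprn_ge0.
apply: (@le_trans _ _ (\sum_(k < K + M) if (k < K)%N then 0 else C / 2 ^+ k)).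
  rewrite -!(big_mkord predT (fun k => if (k < K)%N then 0 else C / 2 ^+ k)).
  rewrite (big_cat_nat _ (leq_addl K M))//= lerDl sumr_ge0// => k _.
  by case: ifP.
rewrite big_split_ord/= big1 ?add0r; last by move=> k _; rewrite ltn_ord.
under eq_bigr do rewrite ltnNge leq_addr/= exprD invfM mulrA.
apply: (le_trans (sum_geometric_le _ (e0 K))).
rewrite mulrA gerBl; apply: divr_ge0; rewrite ?exprn_ge0//.
by rewrite -mulrA mulr_ge0.
Qed.

End pairing_sums.

(** * Bounded linear maps *)

Section bounded_linear.
Context {R : realType}.
Implicit Types U V W : normedModType R.

Definition bounded_linear V W (f : V -> W) :=
  linear f /\ exists k : R, forall v, `|f v| <= k * `|v|.

Lemma bounded_linearB V W (f : V -> W) : bounded_linear f ->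
  {morph f : u v / u - v}.
Proof. by move=> [lf _] u v; rewrite addrC -scaleN1r lf scaleN1r addrC. Qed.

Lemma bounded_linearD V W (f : V -> W) : bounded_linear f ->
  {morph f : u v / u + v}.
Proof. by move=> [lf _] u v; rewrite -[u]scale1r lf !scale1r. Qed.

Lemma bounded_linear_comp U V W (g : V -> W) (f : U -> V) :
  bounded_linear g -> bounded_linear f -> bounded_linear (fun u => g (f u)).
Proof.
move=> [lg [k gk]] [lf [l fl]]; split=> [a u v|]; first by rewrite lf lg.
exists (`|k| * l) => v; apply: (le_trans (gk _)).
apply: (@le_trans _ _ (`|k| * `|f v|)).
  by rewrite ler_wpM2r// ler_norm.
by rewrite -mulrA ler_wpM2l.
Qed.

Lemma bounded_linear_id V : bounded_linear (fun v : V => v).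
Proof. by split=> //; exists 1 => v; rewrite mul1r. Qed.

Lemma bounded_linear_add V W (f g : V -> W) :
  bounded_linear f -> bounded_linear g -> bounded_linear (fun v => f v + g v).
Proof.
move=> [lf [k fk]] [lg [l gl]]; split=> [a u v|].
  by rewrite lf lg scalerDr addrACA.
by exists (k + l) => v; rewrite mulrDl (le_trans (ler_normD _ _))// lerD.
Qed.

Lemma bounded_linear_sub V W (f g : V -> W) :
  bounded_linear f -> bounded_linear g -> bounded_linear (fun v => f v - g v).
Proof.
move=> bf [lg [k gk]]; apply: bounded_linear_add => //; split=> [a u v|].
  by rewrite lg opprD scalerN.
by exists k => v; rewrite normrN.
Qed.

Lemma bounded_linear_continuous V W (f : {linear V -> W}) :
  (exists k : R, forall v, `|f v| <= k * `|v|) -> continuous f.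
Proof.
move=> [k fk]; apply/linear_bounded_continuous/linear_boundedP.
exists k; split; first exact: num_real.
by move=> r kr v; rewrite (le_trans (fk v))// ler_wpM2r// ltW.
Qed.

Lemma bounded_linear_isomorphic V W (T : V -> W) (S : W -> V) :
  bounded_linear T -> bounded_linear S -> cancel T S -> cancel S T ->
  isomorphic V W.
Proof.
move=> [lT bT] [lS bS] TK SK.
pose T' : {linear V -> W} := HB.pack T (GRing.isLinear.Build _ _ _ _ T lT).
pose S' : {linear W -> V} := HB.pack S (GRing.isLinear.Build _ _ _ _ S lS).
by exists T', S'; split => //; exact: bounded_linear_continuous.
Qed.

End bounded_linear.

(** * The space l1 *)

Section ell1_operators.
Context {R : realType}.
Local Notation l1 := (ell1 R).
Implicit Types a b : l1.

Let series_abs (u : nat -> R) N :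
  [series `|u n|]_n N = \sum_(n < N) `|u n| :> R.
Proof. by rewrite /series/= big_mkord. Qed.

Let series_abs_nd (u : nat -> R) : nondecreasing_seq [series `|u n|]_n.
Proof. by apply: nondecreasing_series => ? _ _; exact: normr_ge0. Qed.

Lemma ell1_sum_cvg a :
  (fun N => \sum_(n < N) `|ell1_seq a n|) @ \oo --> `|a|.
Proof.
rewrite (_ : (fun N => _) = [series `|ell1_seq a n|]_n); last first.
  by apply/funext => N; rewrite series_abs.
by case: a => u usum; exact: (set_mem usum).
Qed.

Lemma ell1_sum_le a N : \sum_(n < N) `|ell1_seq a n| <= `|a|.
Proof.
rewrite -series_abs; apply: (nondecreasing_cvgn_le (@series_abs_nd _)).
by case: a => a /= /set_mem.
Qed.

Lemma ell1_norm_le a k :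
  (forall N, \sum_(n < N) `|ell1_seq a n| <= k) -> `|a| <= k.
Proof.
move=> ak; apply: limr_le; first by case: a {ak} => a /= /set_mem.
by apply: nearW => N; rewrite series_abs.
Qed.

Lemma abs_summable_bounded (u : nat -> R) k :
  (forall N, \sum_(n < N) `|u n| <= k) -> abs_summable u.
Proof.
move=> uk; apply: nondecreasing_is_cvgn; first exact: series_abs_nd.
by exists k => _ [N _ <-]; rewrite series_abs.
Qed.

Definition mk_ell1 (u : nat -> R) k
    (uk : forall N, \sum_(n < N) `|u n| <= k) : l1 :=
  @SubspaceOf R (nat -> R^o) _ (abs_summable_subspace R) u
    (mem_set (abs_summable_bounded uk)).

Lemma ell1_ext a b : (forall n, ell1_seq a n = ell1_seq b n) -> a = b.
Proof. by move=> ab; apply/val_inj/funext. Qed.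

Lemma ell1_seq_linear c a b n :
  ell1_seq (c *: a + b) n = c * ell1_seq a n + ell1_seq b n.
Proof. by []. Qed.

Lemma ell1_sum_uniq_le a (s : seq nat) : uniq s ->
  \sum_(n <- s) `|ell1_seq a n| <= `|a|.
Proof.
move=> us; have [N sN] := nat_seq_bounded s.
apply: (le_trans _ (ell1_sum_le a N)).
rewrite -(big_mkord predT (fun n => `|ell1_seq a n|)) /index_iota subn0.
apply: ler_sum_uniq_sub; rewrite ?iota_uniq// => n /sN.
by rewrite mem_iota.
Qed.

(** Reading along a partial injection covers at once restrictions to a block of
    coordinates, extensions by zero and shifts. *)
Section reindex.
Variable sigma : nat -> option nat.
Hypothesis sigma_inj : forall i j m,
  sigma i = Some m -> sigma j = Some m -> i = j.

Let pmap_sigma_uniq (s : seq nat) : uniq s -> uniq (pmap sigma s).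
Proof.
elim: s => // i s IH /= /andP[is_ us].
case E : (sigma i) => [m|] /=; last exact: IH.
rewrite IH// andbT mem_pmap; apply/negP => /mapP[j js].
by move/esym/sigma_inj => /(_ i E) ji; move: is_; rewrite -ji js.
Qed.

Let reindex_bound a N :
  \sum_(n < N) `|oapp (ell1_seq a) 0 (sigma n)| <= `|a|.
Proof.
apply: (le_trans _ (ell1_sum_uniq_le a (pmap_sigma_uniq (iota_uniq 0 N)))).
rewrite -(big_mkord predT (fun n => `|oapp (ell1_seq a) 0 (sigma n)|)).
rewrite /index_iota subn0 le_eqVlt; apply/orP; left; apply/eqP.
elim: (iota 0 N) => [|i s IH]; first by rewrite !big_nil.
rewrite big_cons IH/=; case: (sigma i) => [m|] /=; first by rewrite big_cons.
by rewrite normr0 add0r.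
Qed.

Definition ell1_reindex a : l1 :=
  @mk_ell1 (fun n => oapp (ell1_seq a) 0 (sigma n)) _ (reindex_bound a).

Lemma ell1_reindexE a n :
  ell1_seq (ell1_reindex a) n = oapp (ell1_seq a) 0 (sigma n).
Proof. by []. Qed.

Lemma bounded_linear_ell1_reindex : bounded_linear ell1_reindex.
Proof.
split=> [c a b|].
  apply/ell1_ext => n; rewrite ell1_seq_linear !ell1_reindexE.
  by case: (sigma n) => [m|] /=; rewrite ?mulr0 ?addr0.
by exists 1 => a; rewrite mul1r; apply: ell1_norm_le => N; exact: reindex_bound.
Qed.

End reindex.

(** The bijection between [nat] and [nat * nat] splits a sequence into countably
    many blocks. *)
Definition block_index (k l : nat) : option nat := Some (pair_code (k, l)).

Lemma block_index_inj k i j m :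
  block_index k i = Some m -> block_index k j = Some m -> i = j.
Proof.
move=> [<-] [] /(can_inj pair_codeK) [] //.
Qed.

Definition block (k : nat) : l1 -> l1 := ell1_reindex (@block_index_inj k).

Lemma blockE k a l : ell1_seq (block k a) l = ell1_seq a (pair_code (k, l)).
Proof. by []. Qed.

Lemma block_ext a b : (forall k, block k a = block k b) -> a = b.
Proof.
move=> ab; apply/ell1_ext => n; rewrite -(unpairK n).
by case: (unpair n) => k l; rewrite -!blockE ab.
Qed.

Lemma blockD k a b : block k (a + b) = block k a + block k b.
Proof. exact/bounded_linearD/bounded_linear_ell1_reindex. Qed.

Lemma blockB k a b : block k (a - b) = block k a - block k b.
Proof. exact/bounded_linearB/bounded_linear_ell1_reindex. Qed.

Lemma sum_norm_block_le a K : \sum_(k < K) `|block k a| <= `|a|.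
Proof.
have bnd L : \sum_(k < K) \sum_(l < L) `|ell1_seq (block k a) l| <= `|a|.
  rewrite -(sum_nat_box (fun p => `|ell1_seq a (pair_code p)|)).
  rewrite -(big_map pair_code predT (fun n => `|ell1_seq a n|)).
  apply: ell1_sum_uniq_le; rewrite map_inj_uniq ?nat_box_uniq//.
  exact: can_inj pair_codeK.
have : (fun L => \sum_(k < K) \sum_(l < L) `|ell1_seq (block k a) l|) @ \oo
    --> \sum_(k < K) `|block k a|.
  by apply: cvg_big => [|k _]; [exact: add_continuous|exact: ell1_sum_cvg].
move=> cv; rewrite -(cvg_lim (@Rhausdorff R) cv); apply: limr_le.
  by apply/cvg_ex; eexists; exact: cv.
by apply: nearW.
Qed.

Section blockwise.
Variables (Q : l1 -> l1) (Q_blin : bounded_linear Q).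

Let bound := sval (cid Q_blin.2).

Let blockwise_bound a N :
  \sum_(n < N) `|ell1_seq (Q (block (unpair n).1 a)) (unpair n).2|
    <= `|bound| * `|a|.
Proof.
apply: (sum_unpair_le (g := fun k l => `|ell1_seq (Q (block k a)) l|)) => // K L.
apply: (@le_trans _ _ (\sum_(k < K) `|bound| * `|block k a|)).
  apply: ler_sum => k _; apply: (le_trans (ell1_sum_le _ _)).
  rewrite /bound; case: cid => M /= QM; apply: (le_trans (QM _)).
  by rewrite ler_wpM2r// ler_norm.
by rewrite -mulr_sumr ler_wpM2l// sum_norm_block_le.
Qed.

Definition blockwise a : l1 :=
  @mk_ell1 (fun n => ell1_seq (Q (block (unpair n).1 a)) (unpair n).2) _
    (blockwise_bound a).

Lemma block_blockwise k a : block k (blockwise a) = Q (block k a).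
Proof. by apply/ell1_ext => l; rewrite blockE/= /ell1_seq/= pair_codeK. Qed.

Lemma bounded_linear_blockwise : bounded_linear blockwise.
Proof.
split=> [c a b|].
  apply/block_ext => k.
  have bl : linear (block k) by exact: (bounded_linear_ell1_reindex _).1.
  by rewrite bl !block_blockwise bl Q_blin.1.
by exists `|bound| => a; apply: ell1_norm_le => N; exact: blockwise_bound.
Qed.

End blockwise.

Definition shift_index n : option nat :=
  let p := unpair n in Some (pair_code (p.1.+1, p.2)).

Lemma shift_index_inj i j m :
  shift_index i = Some m -> shift_index j = Some m -> i = j.
Proof.
move=> [<-] [] /(can_inj pair_codeK) [e1 e2]; apply: (can_inj unpairK).
by case: (unpair i) (unpair j) e1 e2 => [? ?] [? ?] /= -> ->.
Qed.

Definition unshift_index n : option nat :=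
  let p := unpair n in if p.1 is k.+1 then Some (pair_code (k, p.2)) else None.

Lemma unshift_index_inj i j m :
  unshift_index i = Some m -> unshift_index j = Some m -> i = j.
Proof.
rewrite /unshift_index; case Ei : (unpair i) => [[|k] l] //= [<-].
case Ej : (unpair j) => [[|k'] l'] //= [] /(can_inj pair_codeK) [e1 e2].
by apply: (can_inj unpairK); rewrite Ei Ej e1 e2.
Qed.

Definition embed_index n : option nat :=
  let p := unpair n in if p.1 is 0%N then Some p.2 else None.

Lemma embed_index_inj i j m :
  embed_index i = Some m -> embed_index j = Some m -> i = j.
Proof.
rewrite /embed_index; case Ei : (unpair i) => [[|k] l] //= [<-].
case Ej : (unpair j) => [[|k'] l'] //= [e].
by apply: (can_inj unpairK); rewrite Ei Ej e.
Qed.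

Definition shift_blocks : l1 -> l1 := ell1_reindex shift_index_inj.
Definition unshift_blocks : l1 -> l1 := ell1_reindex unshift_index_inj.
Definition embed_block : l1 -> l1 := ell1_reindex embed_index_inj.

Lemma block_shift k a : block k (shift_blocks a) = block k.+1 a.
Proof.
by apply/ell1_ext => l; rewrite blockE ell1_reindexE /shift_index pair_codeK.
Qed.

Lemma block_unshift k a :
  block k (unshift_blocks a) = if k is k'.+1 then block k' a else 0.
Proof.
apply/ell1_ext => l; rewrite blockE ell1_reindexE /unshift_index pair_codeK/=.
by case: k.
Qed.

Lemma block_embed k a : block k (embed_block a) = if k is 0%N then a else 0.
Proof.
apply/ell1_ext => l; rewrite blockE ell1_reindexE /embed_index pair_codeK/=.
by case: k.
Qed.

(** * Pelczynski's decomposition *)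

Section decomposition.
Variables (V : normedModType R).
Variables (A : V -> l1) (B : l1 -> V) (b : V -> l1) (a : l1 -> V).
Hypotheses (blA : bounded_linear A) (blB : bounded_linear B).
Hypotheses (bla : bounded_linear a) (blb : bounded_linear b).
Hypotheses (BA : forall v, B (A v) = v) (ba : forall y, b (a y) = y).

Let P z := A (B z).
Let blP : bounded_linear P. Proof. exact: bounded_linear_comp. Qed.
Let bP := blockwise blP.
Let bl_bP : bounded_linear bP. Proof. exact: bounded_linear_blockwise. Qed.

Let B_P z : B (P z) = B z. Proof. exact: BA. Qed.
Let P_A v : P (A v) = A v. Proof. by rewrite /P BA. Qed.

Let bl_block k : bounded_linear (block k).
Proof. exact: bounded_linear_ell1_reindex. Qed.
Let bl_shift : bounded_linear shift_blocks.
Proof. exact: bounded_linear_ell1_reindex. Qed.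
Let bl_unshift : bounded_linear unshift_blocks.
Proof. exact: bounded_linear_ell1_reindex. Qed.
Let bl_embed : bounded_linear embed_block.
Proof. exact: bounded_linear_ell1_reindex. Qed.

(* the isomorphism between l1 and V * l1 *)
Let split_V (z : l1) : V := B (block 0 z).
Let split_l1 (z : l1) : l1 := z - bP z + bP (shift_blocks z).
Let glue (v : V) (y : l1) : l1 :=
  embed_block (A v) + (y - bP y) + unshift_blocks (bP y).

Let block_split k z :
  block k (split_l1 z) = block k z - P (block k z) + P (block k.+1 z).
Proof. by rewrite /split_l1 blockD blockB !block_blockwise block_shift. Qed.

Let block_glue k v y : block k (glue v y) =
  (if k is 0%N then A v else P (block k.-1 y)) + (block k y - P (block k y)).
Proof.
rewrite /glue 2!blockD blockB block_embed block_unshift block_blockwise.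
case: k => [|k] /=; first by rewrite addr0.
by rewrite add0r block_blockwise addrC.
Qed.

Let P_idem z : P (P z) = P z. Proof. by rewrite {2}/P P_A. Qed.

Let PD := bounded_linearD blP.
Let PB := bounded_linearB blP.
Let BD := bounded_linearD blB.
Let BB := bounded_linearB blB.

Let split_V_glue v y : split_V (glue v y) = v.
Proof. by rewrite /split_V block_glue BD BB B_P subrr addr0 BA. Qed.

Let split_l1_glue v y : split_l1 (glue v y) = y.
Proof.
have Pu x u : P (x + (u - P u)) = P x by rewrite PD PB P_idem subrr addr0.
apply/block_ext => k; rewrite block_split !block_glue.
by case: k => [|k] /=; rewrite !Pu !P_idem ?P_A [X in X - _ + _]addrC addrK subrK.
Qed.

Let glue_split z : glue (split_V z) (split_l1 z) = z.
Proof.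
apply/block_ext => k; rewrite block_glue !block_split.
have PS j : P (block j z - P (block j z) + P (block j.+1 z)) = P (block j.+1 z).
  by rewrite PD PB !P_idem subrr add0r.
by case: k => [|k] /=; rewrite ?block_split !PS addrK addrC subrK.
Qed.

(* the isomorphism between V and V * l1: block 0 of b v stays in V, the other
   blocks are moved to l1 *)
Let V1 (v : V) : V := v - a (b v) + a (block 0 (b v)).
Let V2 (v : V) : l1 := shift_blocks (b v).
Let V12 (v : V) (y : l1) : V :=
  v - a (b v) + a (embed_block (b v) + unshift_blocks y).

Let bD := bounded_linearD blb.
Let bB := bounded_linearB blb.

Let b_V1 v : b (V1 v) = block 0 (b v).
Proof. by rewrite /V1 bD bB !ba subrr add0r. Qed.

Let b_V12 v y : b (V12 v y) = embed_block (b v) + unshift_blocks y.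
Proof. by rewrite /V12 bD bB !ba subrr add0r. Qed.

Let V12K v : V12 (V1 v) (V2 v) = v.
Proof.
rewrite /V12 b_V1.
have -> : embed_block (block 0 (b v)) + unshift_blocks (V2 v) = b v.
  apply/block_ext => k; rewrite blockD block_embed block_unshift.
  by case: k => [|k]; rewrite ?addr0// add0r block_shift.
by rewrite /V1 addrK subrK.
Qed.

Let V1_V12 v y : V1 (V12 v y) = v.
Proof.
rewrite /V1 b_V12 blockD block_embed block_unshift addr0 {1}/V12 addrK.
by rewrite subrK.
Qed.

Let V2_V12 v y : V2 (V12 v y) = y.
Proof.
rewrite /V2 b_V12; apply/block_ext => k.
by rewrite block_shift blockD block_embed block_unshift add0r.
Qed.

(** With [P] the projection [A \o B], the sequences of blocks
    [(z_k)] correspond to pairs of an element of [V] and a sequence of blocks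
    through [z |-> (B z_0, (z_k - P z_k + P z_(k+1))_k)], so [l1] is
    isomorphic to [V * l1]; and [V], having [l1 = l1 * l1] as a complemented
    subspace, is isomorphic to [V * l1] as well. *)
Theorem complemented_ell1_isomorphic : isomorphic V l1.
Proof.
pose T v := glue (V1 v) (V2 v).
pose S z := V12 (split_V z) (split_l1 z).
have blV1 : bounded_linear V1.
  apply: bounded_linear_add.
    by apply: bounded_linear_sub;
      [exact: bounded_linear_id|exact: bounded_linear_comp].
  by apply: (bounded_linear_comp bla (bounded_linear_comp _ blb)).
have blV2 : bounded_linear V2 by exact: bounded_linear_comp.
have bl_split_V : bounded_linear split_V by exact: bounded_linear_comp.
have bl_split_l1 : bounded_linear split_l1.
  apply: bounded_linear_add; last exact: bounded_linear_comp.
  by apply: bounded_linear_sub => //; exact: bounded_linear_id.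
apply: (@bounded_linear_isomorphic _ _ _ T S).
- apply: bounded_linear_add; last first.
    by apply: (bounded_linear_comp bl_unshift); exact: bounded_linear_comp.
  apply: bounded_linear_add.
    by apply: (bounded_linear_comp bl_embed); exact: bounded_linear_comp.
  by apply: bounded_linear_sub => //; exact: bounded_linear_comp.
- apply: bounded_linear_add.
    apply: bounded_linear_sub => //.
    by apply: (bounded_linear_comp bla); exact: bounded_linear_comp.
  apply: (bounded_linear_comp bla); apply: bounded_linear_add; last first.
    exact: bounded_linear_comp.
  by apply: (bounded_linear_comp bl_embed); exact: bounded_linear_comp.
- by move=> v; rewrite /S /T split_V_glue split_l1_glue V12K.
- by move=> z; rewrite /S /T V1_V12 V2_V12 glue_split.
Qed.

End decomposition.

End ell1_operators.

(** * Operators between the Lipschitz-free space and l1 *)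

Lemma cvgn_eventually_le (R : realType) (u : nat -> R) (l k : R) (N : nat) :
  u @ \oo --> l -> (forall n, (N <= n)%N -> u n <= k) -> l <= k.
Proof.
move=> ul uk; rewrite -(cvg_lim (@Rhausdorff R) ul); apply: limr_le.
  by apply/cvg_ex; exists l.
by exists N.
Qed.

Section free_space_operators.
Context {R : realType} (M : metricType R) (q : M).
Local Notation LFM := (LF q).
Local Notation l1 := (ell1 R).
Implicit Types (m : LFM) (f : Lip0 q).

Definition pairing m f : R := dual_fun (subspace_val m : dual (Lip0 q)) f.

Lemma pairing_le m f : `|pairing m f| <= `|m| * `|f|.
Proof. exact: op_normP. Qed.

Lemma LF_norm_le m k : 0 <= k ->
  (forall f, `|pairing m f| <= k * `|f|) -> `|m| <= k.
Proof. exact: op_norm_le. Qed.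

Lemma pairing_linearl c m n f :
  pairing (c *: m + n) f = c * pairing m f + pairing n f.
Proof. exact: (dual_funP c (subspace_val m) (subspace_val n)). Qed.

Lemma pairingBl m n f : pairing (m - n) f = pairing m f - pairing n f.
Proof. by rewrite addrC -scaleN1r pairing_linearl mulN1r addrC. Qed.

Lemma pairing_linearr m c f g :
  pairing m (c *: f + g) = c * pairing m f + pairing m g.
Proof. exact: dual_linear. Qed.

Lemma LF_ext m n : (forall f, pairing m f = pairing n f) -> m = n.
Proof. by move=> mn; apply/val_inj/val_inj/funext. Qed.

Lemma span_sub_free_set :
  linear_span (range (delta q)) `<=` @lip_free_set R M q.
Proof. exact: subset_closure. Qed.

Lemma delta_in_span x : linear_span (range (delta q)) (delta q x).
Proof.
exists 1%N, (fun=> 1), (fun=> delta q x); split; first by move=> _; exists x.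
by rewrite big_ord1 scale1r.
Qed.

Definition free_delta x : LFM :=
  SubspaceOf (mem_set (span_sub_free_set (delta_in_span x)) :
    delta q x \in subspace_pred (lip_free_subspace q)).

Lemma pairing_delta x f : pairing (free_delta x) f = lip0_fun f x.
Proof. by []. Qed.

(** Finite combinations of evaluations are dense in the free space. *)
Lemma bounded_linear_delta0 (V : normedModType R) (H : LFM -> V) :
  bounded_linear H -> (forall x, H (free_delta x) = 0) -> forall m, H m = 0.
Proof.
move=> [lH [k Hk]] H0 m.
have H00 : H 0 = 0.
  by have := bounded_linearB (conj lH (ex_intro _ k Hk)) 0 0; rewrite !subrr.
have span n (a : 'I_n -> R) (u : 'I_n -> dual (Lip0 q)) :
    (forall i, range (delta q) (u i)) ->
    exists2 p : LFM, subspace_val p = \sum_(i < n) a i *: u i & H p = 0.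
  elim: n a u => [|n IH] a u ua; first by exists 0; rewrite ?big_ord0.
  have [p pE p0] := IH (a \o widen_ord (leqnSn n)) (u \o widen_ord (leqnSn n))
    (fun i => ua _).
  have [x _ xu] := ua ord_max.
  exists (a ord_max *: free_delta x + p); last by rewrite lH H0 p0 scaler0 addr0.
  by rewrite big_ord_recr/= -xu addrC -pE.
apply/normr0_eq0/eqP; rewrite eq_le normr_ge0 andbT.
apply/ler_addgt0Pl => e e0; rewrite addr0.
pose k' := `|k| + 1; have k'0 : 0 < k' by rewrite ltr_pwDr.
have [mv mP] : exists mv, mv = (subspace_val m : dual (Lip0 q)) by eexists.
have cl : lip_free_set mv.
  by rewrite mP; case: m {mP} => m' /= hm; exact: (set_mem hm).
have [_ [[n [a [u [ua ->]]]]]] := cl _ (nbhsx_ballx mv _ (divr_gt0 e0 k'0)).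
rewrite -ball_normE/= => mu.
have [p pE p0] := span n a u ua.
have -> : H m = H (m - p).
  by rewrite (bounded_linearB (conj lH (ex_intro _ k Hk))) p0 subr0.
apply: (le_trans (Hk _)); apply: (@le_trans _ _ (k' * `|m - p|)).
  by rewrite ler_wpM2r// /k' (le_trans (ler_norm _))// lerDl.
rewrite mulrC -ler_pdivlMr// ltW//.
by move: mu; rewrite mP -pE.
Qed.

Lemma bounded_linear_delta_ext (V : normedModType R) (F G : LFM -> V) :
  bounded_linear F -> bounded_linear G ->
  (forall x, F (free_delta x) = G (free_delta x)) -> F =1 G.
Proof.
move=> bF bG FG m; apply/eqP; rewrite -subr_eq0; apply/eqP.
move: m; apply: bounded_linear_delta0; first exact: bounded_linear_sub.
by move=> x; rewrite FG subrr.
Qed.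

Let sum_scaleS (V : lmodType R) N (a : nat -> R) (u : nat -> V) :
  \sum_(c < N.+1) a c *: u c = a N *: u N + \sum_(c < N) a c *: u c.
Proof. by rewrite big_ord_recr addrC. Qed.

Lemma lip0_fun_sum N (a : nat -> R) (F : nat -> Lip0 q) x :
  lip0_fun (\sum_(c < N) a c *: F c) x = \sum_(c < N) a c * lip0_fun (F c) x.
Proof.
elim: N => [|N IH]; first by rewrite !big_ord0.
by rewrite sum_scaleS lip0_funP IH big_ord_recr addrC.
Qed.

Lemma pairing_sumr m N (a : nat -> R) (F : nat -> Lip0 q) :
  pairing m (\sum_(c < N) a c *: F c) = \sum_(c < N) a c * pairing m (F c).
Proof.
elim: N => [|N IH].
  rewrite !big_ord0; have := pairing_linearr m (-1) 0 0.
  by rewrite scaler0 addr0 mulN1r addNr.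
by rewrite sum_scaleS pairing_linearr IH big_ord_recr addrC.
Qed.

Lemma pairing_suml N (a : nat -> R) (v : nat -> LFM) f :
  pairing (\sum_(c < N) a c *: v c) f = \sum_(c < N) a c * pairing (v c) f.
Proof.
elim: N => [|N IH]; first by rewrite !big_ord0.
by rewrite sum_scaleS pairing_linearl IH big_ord_recr addrC.
Qed.

Section analysis.
Variables (F : nat -> Lip0 q) (C : R).
Hypothesis C0 : 0 <= C.
Hypothesis FC : forall N x y,
  \sum_(c < N) `|lip0_fun (F c) x - lip0_fun (F c) y| <= C * mdist x y.

(** Choosing the signs [e c] of the values [pairing m (F c)], the sum of the
    absolute values is [pairing m] of the [C]-Lipschitz function
    [\sum_c e c *: F c]. *)
Lemma sum_pairing_le m N : \sum_(c < N) `|pairing m (F c)| <= C * `|m|.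
Proof.
pose e c := Num.sg (pairing m (F c)).
have -> : \sum_(c < N) `|pairing m (F c)| = pairing m (\sum_(c < N) e c *: F c).
  by rewrite pairing_sumr; apply: eq_bigr => c _; rewrite normrEsg.
apply: (le_trans (ler_norm _)); apply: (le_trans (pairing_le _ _)).
rewrite mulrC ler_wpM2r//; apply: lip_norm_le => // x y.
apply: (le_trans _ (FC N x y)).
rewrite !lip0_fun_sum -sumrB; apply: (le_trans (ler_norm_sum _ _ _)).
apply: ler_sum => c _; rewrite -mulrBr normrM ler_piMl//.
by rewrite /e normr_sg lern1; case: (_ == 0).
Qed.

Definition analysis m : l1 :=
  @mk_ell1 R (fun c => pairing m (F c)) _ (sum_pairing_le m).

Lemma analysisE m c : ell1_seq (analysis m) c = pairing m (F c).
Proof. by []. Qed.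

Lemma bounded_linear_analysis : bounded_linear analysis.
Proof.
split=> [c m n|].
  by apply/ell1_ext => i; rewrite ell1_seq_linear !analysisE pairing_linearl.
by exists C => m; apply: ell1_norm_le => N; exact: sum_pairing_le.
Qed.

End analysis.

(** The partial sums converge uniformly on the unit ball of [Lip0 q], so that
    the limit functional stays in the closed span of the evaluations. *)
Section synthesis.
Variables (v : nat -> LFM) (C : R).
Hypothesis C0 : 0 <= C.
Hypothesis vC : forall c, `|v c| <= C.
Implicit Types a : l1.

Let psum a f N : R := \sum_(c < N) ell1_seq a c * pairing (v c) f.

Let tail a N : R := `|a| - \sum_(c < N) `|ell1_seq a c|.

Let tail_ge0 a N : 0 <= tail a N.
Proof. by rewrite subr_ge0 ell1_sum_le. Qed.

Let psum_diff a f N K : (N <= K)%N ->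
  `|psum a f K - psum a f N| <= C * tail a N * `|f|.
Proof.
move=> NK; rewrite /psum.
rewrite -!(big_mkord predT (fun c => ell1_seq a c * pairing (v c) f)).
rewrite (big_cat_nat _ NK)//= addrAC subrr add0r.
apply: (le_trans (ler_norm_sum _ _ _)).
apply: (@le_trans _ _ (C * `|f| * \sum_(N <= c < K) `|ell1_seq a c|)).
  rewrite mulr_sumr; apply: ler_sum => c _; rewrite normrM mulrC ler_wpM2r//.
  by rewrite (le_trans (pairing_le _ _))// ler_wpM2r.
rewrite [leRHS]mulrAC ler_wpM2l ?mulr_ge0// lerBrDr addrC.
have := ell1_sum_le a K; rewrite -(big_mkord predT (fun c => `|ell1_seq a c|)).
by rewrite (big_cat_nat _ NK)//= big_mkord.
Qed.

Let psum_cvg a f : cvgn (psum a f).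
Proof.
have -> : psum a f = series (fun c => ell1_seq a c * pairing (v c) f).
  by apply/funext => N; rewrite /series/= big_mkord.
apply: normed_cvg.
apply: (@abs_summable_bounded _ _ (C * `|f| * `|a|)) => N.
apply: (@le_trans _ _ (C * `|f| * \sum_(c < N) `|ell1_seq a c|)).
  rewrite mulr_sumr; apply: ler_sum => c _; rewrite normrM mulrC ler_wpM2r//.
  by rewrite (le_trans (pairing_le _ _))// ler_wpM2r.
by rewrite ler_wpM2l ?ell1_sum_le// mulr_ge0.
Qed.

Let lsum a f : R := limn (psum a f).

Let lsum_cvg a f : psum a f @ \oo --> lsum a f.
Proof. exact: psum_cvg. Qed.

Let lsum_diff a f N : `|lsum a f - psum a f N| <= C * tail a N * `|f|.
Proof.
have cv : (fun K => `|psum a f K - psum a f N|) @ \oo -->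
    `|lsum a f - psum a f N|.
  by apply: cvg_norm; apply: cvgB; [exact: lsum_cvg|exact: cvg_cst].
apply: (cvgn_eventually_le cv) => K; exact: psum_diff.
Qed.

Let lsum_le a f : `|lsum a f| <= C * `|a| * `|f|.
Proof.
have := lsum_diff a f 0; rewrite /psum /tail !big_ord0 !subr0.
by [].
Qed.

Let lsum_linear a : linear (lsum a : _ -> R^o).
Proof.
move=> c f g; apply: (cvg_lim (@Rhausdorff R)).
have -> : psum a (c *: f + g) = (fun N => c * psum a f N + psum a g N).
  apply/funext => N; rewrite /psum mulr_sumr -big_split/=; apply: eq_bigr => i _.
  by rewrite pairing_linearr mulrDr mulrCA.
by apply: cvgD; [apply: cvgMr|]; exact: lsum_cvg.
Qed.

Let lsum_bounded a : exists k : R, forall f, `|lsum a f| <= k * `|f|.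
Proof. by exists (C * `|a|) => f; exact: lsum_le. Qed.

Let lsum_dual a : dual (Lip0 q) := mk_dual (@lsum_linear a) (lsum_bounded a).

Let lsum_free a : lip_free_set (lsum_dual a).
Proof.
apply: closed_closure => U /nbhs_ballP[e /= e0 eU].
have C1 : 0 < C + 1 by rewrite ltr_pwDr.
have [N tN] : exists N, tail a N < e / (C + 1).
  have /cvgrPdist_lt := @ell1_sum_cvg _ a.
  move=> /(_ _ (divr_gt0 e0 C1)) [N _ /(_ N (leqnn N))].
  by rewrite ger0_norm ?tail_ge0// => ?; exists N.
pose p : LFM := \sum_(c < N) ell1_seq a c *: v c.
exists (subspace_val p); split.
  by case: (p) => p' hp /=; exact: (set_mem hp).
apply: eU; rewrite -ball_normE/=.
apply: (@le_lt_trans _ _ (C * tail a N)).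
  apply: op_norm_le; first by rewrite mulr_ge0.
  move=> f; apply: le_trans (lsum_diff a f N).
  by rewrite /psum -pairing_suml.
apply: (@le_lt_trans _ _ ((C + 1) * tail a N)); first by rewrite ler_wpM2r// lerDl.
by rewrite mulrC -ltr_pdivlMr.
Qed.

Definition synthesis a : LFM :=
  SubspaceOf (mem_set (@lsum_free a) :
    lsum_dual a \in subspace_pred (lip_free_subspace q)).

Lemma synthesis_cvg a f :
  (fun N => \sum_(c < N) ell1_seq a c * pairing (v c) f) @ \oo -->
  pairing (synthesis a) f.
Proof. exact: lsum_cvg. Qed.

Lemma bounded_linear_synthesis : bounded_linear synthesis.
Proof.
split=> [c a b|].
  apply: LF_ext => f; rewrite pairing_linearl.
  have synE d : pairing (synthesis d) f = lsum d f by [].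
  rewrite !synE; apply: (cvg_lim (@Rhausdorff R)).
  have -> : psum (c *: a + b) f = (fun N => c * psum a f N + psum b f N).
    apply/funext => N; rewrite /psum mulr_sumr -big_split.
    by apply: eq_bigr => i _; rewrite ell1_seq_linear mulrDl mulrA.
  by apply: cvgD; [apply: cvgMr|]; exact: lsum_cvg.
exists C => a; apply: LF_norm_le; first by rewrite mulr_ge0.
exact: lsum_le.
Qed.

End synthesis.

(** A biorthogonal system exhibits l1 as a complemented subspace: [synthesis]
    embeds it and [analysis] projects onto it. *)
Lemma biorthogonal_analysis_synthesis (F : nat -> Lip0 q) (C D : R)
    (C0 : 0 <= C) (D0 : 0 <= D)
    (FC : forall N x y,
      \sum_(c < N) `|lip0_fun (F c) x - lip0_fun (F c) y| <= C * mdist x y)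
    (v : nat -> LFM) (vD : forall c, `|v c| <= D) :
  (forall c n, pairing (v c) (F n) = (c == n)%:R) ->
  forall y, analysis C0 FC (synthesis D0 vD y) = y.
Proof.
move=> vF y; apply/ell1_ext => n; rewrite analysisE.
rewrite -(cvg_lim (@Rhausdorff R) (@synthesis_cvg _ _ D0 vD y (F n))).
apply: (cvg_lim (@Rhausdorff R)).
apply: cvg_near_cst; exists n.+1 => // N /= nN.
rewrite (bigD1 (Ordinal nN))//= vF eqxx mulr1 big1 ?addr0// => i /negPf ni.
by rewrite vF -(inj_eq val_inj)/= in ni *; rewrite ni mulr0.
Qed.

End free_space_operators.

(** * A complemented copy of l1 in a Lipschitz-free space *)

Section lipschitz_functions.
Context {R : realType} (M : metricType R) (q : M).

Lemma lipschitz0_sub (f : M -> R) k :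
  (forall x y, `|f x - f y| <= k * mdist x y) ->
  lipschitz0 q (fun x => f x - f q : R^o).
Proof.
move=> fk; split; first exact: subrr.
by exists k => x y; rewrite opprB addrA subrK.
Qed.

Definition mk_lip0 (f : M -> R) k
    (fk : forall x y, `|f x - f y| <= k * mdist x y) : Lip0 q :=
  @SubspaceOf R (M -> R^o) _ (lipschitz0_subspace q) _
    (mem_set (lipschitz0_sub fk)).

Lemma mk_lip0E f k fk x : lip0_fun (@mk_lip0 f k fk) x = f x - f q.
Proof. by []. Qed.

Lemma mk_lip0B f k fk x y :
  lip0_fun (@mk_lip0 f k fk) x - lip0_fun (mk_lip0 fk) y = f x - f y.
Proof. by rewrite !mk_lip0E opprB addrA subrK. Qed.

Lemma molecule_norm_le x y :
  `|free_delta q x - free_delta q y| <= mdist x y.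
Proof.
apply: LF_norm_le => [|f]; first exact: mdist_ge0.
by rewrite pairingBl !pairing_delta mulrC lip_normP.
Qed.

(** Only the indices active at [x] or at [y] contribute to the sum. *)
Lemma sum_lipschitz_multiplicity (h : nat -> M -> R) (n : nat) (l : R) :
  (forall c x y, `|h c x - h c y| <= l * mdist x y) ->
  (forall x (s : seq nat), uniq s -> all (fun c => h c x != 0) s ->
    (size s <= n.+1)%N) ->
  forall N x y,
    \sum_(c < N) `|h c x - h c y| <= 2 * n.+1%:R * (l * mdist x y).
Proof.
move=> hl hn N x y; set e := l * mdist x y.
have e0 : 0 <= e by exact: le_trans (hl 0%N x y).
have active z : \sum_(c < N) (if h c z != 0 then e else 0) <= n.+1%:R * e.
  rewrite -(big_mkord predT (fun c => if h c z != 0 then e else 0)).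
  rewrite /index_iota subn0 -big_mkcond -big_filter big_const_seq count_predT.
  rewrite iter_addr_0 -[e *+ _]mulr_natl ler_wpM2r// ler_nat.
  by apply: (hn z); rewrite ?filter_uniq ?iota_uniq// filter_all.
rewrite -mulrA mulrDl mul1r; apply: (le_trans _ (lerD (active x) (active y))).
rewrite -big_split/=; apply: ler_sum => c _.
case: eqVneq => [hx|_] /=; case: eqVneq => [hy|_] /=.
- by rewrite hx hy subrr normr0 addr0.
- by rewrite add0r hl.
- by rewrite addr0 hl.
- by apply: (le_trans (hl _ _ _)); rewrite lerDl.
Qed.

End lipschitz_functions.

Section bump_sequence.
Context {R : realType} (M : metricType R) (q : M).

(** The balls of center [x n] and radius [r n] are disjoint and contain none of
    the [y m]. Hence the cones on these balls are biorthogonal to the molecules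
    [(r n)^-1 *: (delta (x n) - delta (y n))], whose norms are at most [K]. *)
Record bump_sequence (x y : nat -> M) (r : nat -> R) (K : R) : Prop :=
  BumpSequence {
    bump_gt0 : forall n, 0 < r n ;
    bump_dist : forall n, mdist (x n) (y n) <= K * r n ;
    bump_centers : forall n m, (n < m)%N -> r n + r m <= mdist (x n) (x m) ;
    bump_off : forall n m, r n <= mdist (x n) (y m) }.

Lemma bump_sequence_complemented x y r K : bump_sequence x y r K ->
  exists (a : ell1 R -> LF q) (b : LF q -> ell1 R),
    [/\ bounded_linear a, bounded_linear b & forall u, b (a u) = u].
Proof.
move=> [r0 rK rc ro].
pose h n z := Num.max 0 (r n - mdist (x n) z).
have h0 n z : r n <= mdist (x n) z -> h n z = 0.
  by move=> rz; apply/max_idPl; rewrite subr_le0.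
have hpos n z : h n z != 0 -> mdist (x n) z < r n.
  by apply: contraNT; rewrite -leNgt => /h0 ->.
have h_lip n z z' : `|h n z - h n z'| <= 1 * mdist z z'.
  rewrite mul1r /h.
  have t1 := metric_triangle (x n) z z'; have t2 := metric_triangle (x n) z' z.
  rewrite (metric_sym z' z) in t2.
  have d0 := mdist_ge0 z z'.
  by rewrite ler_norml /Num.max; case: ifP => ?; case: ifP => ?; lra.
have h_mult z (s : seq nat) : uniq s -> all (fun c => h c z != 0) s ->
    (size s <= 1)%N.
  case: s => [|c [|d s]] //= /andP[]; rewrite inE negb_or => /andP[cd _] _.
  move=> /and3P[/hpos hc /hpos hd _]; exfalso.
  have t := metric_triangle (x c) z (x d); rewrite (metric_sym z) in t.
  case: (ltngtP c d) cd => // ij _; have := rc _ _ ij; first lra.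
  by rewrite metric_sym; lra.
pose F n := mk_lip0 q (h_lip n).
have FC N u v : \sum_(c < N) `|lip0_fun (F c) u - lip0_fun (F c) v|
    <= 2 * mdist u v.
  under eq_bigr do rewrite mk_lip0B.
  have := sum_lipschitz_multiplicity h_lip h_mult N u v.
  by rewrite mulr1 mul1r.
have K0 : 0 <= K.
  have := le_trans (mdist_ge0 _ _) (rK 0%N).
  by rewrite pmulr_lge0.
pose v n := (r n)^-1 *: (free_delta q (x n) - free_delta q (y n)).
have vK n : `|v n| <= K.
  rewrite normrZ normfV gtr0_norm// mulrC ler_pdivrMr//.
  exact: le_trans (molecule_norm_le _ _ _) (rK n).
have C0 : 0 <= 2 :> R by [].
exists (synthesis K0 vK), (analysis C0 FC); split.
- exact: bounded_linear_synthesis.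
- exact: bounded_linear_analysis.
apply: biorthogonal_analysis_synthesis => c n.
rewrite /v -[_ *: _]addr0 pairing_linearl pairingBl !pairing_delta mk_lip0B.
have -> : pairing 0 (F n) = 0 :> R by [].
rewrite addr0 (h0 n (y c)) ?ro// subr0.
have [->|cn] := eqVneq c n.
  rewrite /h mdistxx subr0 (max_idPr _) ?ltW// mulVf//.
  by rewrite gt_eqF.
rewrite h0 ?mulr0//.
case: (ltngtP c n) cn => // ij _; last by have := rc _ _ ij; have := r0 c; lra.
by have := rc _ _ ij; rewrite metric_sym; have := r0 c; lra.
Qed.

(** The invariant [P Z beta] allows a greedy construction: all later points are
    taken in [Z], all later radii are at most [beta], and [Z] keeps a distance
    from the previous points that leaves room for such radii. *)
Lemma bump_sequence_greedy (P : set M -> R -> Prop) (K : R) Z0 beta0 :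
  P Z0 beta0 ->
  (forall Z beta, P Z beta -> exists x y r Z' beta',
    [/\ Z x /\ Z y, Z' `<=` Z /\ beta' <= beta,
        0 < r <= beta, r <= mdist x y <= K * r &
        P Z' beta' /\
        forall z, Z' z -> r + beta' <= mdist x z /\ beta' <= mdist y z]) ->
  exists x y r, bump_sequence x y r K.
Proof.
move=> P0 step.
have /choice[F FP] : forall s : set M * R, exists o : (M * M * R) * (set M * R),
    P s.1 s.2 ->
    [/\ s.1 o.1.1.1 /\ s.1 o.1.1.2, o.2.1 `<=` s.1 /\ o.2.2 <= s.2,
        0 < o.1.2 <= s.2,
        o.1.2 <= mdist o.1.1.1 o.1.1.2 <= K * o.1.2 &
        P o.2.1 o.2.2 /\ forall z, o.2.1 z ->
          o.1.2 + o.2.2 <= mdist o.1.1.1 z /\ o.2.2 <= mdist o.1.1.2 z].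
  move=> [Z beta]; have [PZ|nPZ] := pselect (P Z beta).
    have [x [y [r [Z' [beta' H]]]]] := step _ _ PZ.
    by exists ((x, y, r), (Z', beta')).
  by exists ((q, q, 0), (Z, beta)).
pose st n := iter n (fun s => (F s).2) (Z0, beta0).
have Pst n : P (st n).1 (st n).2.
  by elim: n => [//|n IH]; have [_ _ _ _ []] := FP _ IH.
pose x n := (F (st n)).1.1.1; pose y n := (F (st n)).1.1.2.
pose r n := (F (st n)).1.2.
have mono n k : (st (n + k)%N).1 `<=` (st n).1 /\ (st (n + k)%N).2 <= (st n).2.
  elim: k => [|k [IH1 IH2]]; first by rewrite addn0; split.
  rewrite addnS; have [_ [H1 H2] _ _ _] := FP _ (Pst (n + k)%N).
  by split; [exact: subset_trans H1 IH1|exact: le_trans H2 IH2].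
have far n m : (n < m)%N -> [/\ r n + r m <= mdist (x n) (x m),
    r n + r m <= mdist (x n) (y m) & r m <= mdist (y n) (x m)].
  move=> nm; have [_ _ _ _ [_ H]] := FP _ (Pst n).
  have [S1 S2] := mono n.+1 (m - n.+1)%N; rewrite subnKC// in S1 S2.
  have [[Zx Zy] _ /andP[_ rb] _ _] := FP _ (Pst m).
  have [Hx1 Hx2] := H _ (S1 _ Zx); have [Hy1 _] := H _ (S1 _ Zy).
  have rm : r m <= (F (st n)).2.2 by exact: le_trans rb S2.
  split; first by apply: le_trans Hx1; rewrite lerD2l.
    by apply: le_trans Hy1; rewrite lerD2l.
  exact: le_trans Hx2.
have rpos n : 0 < r n by have [_ _ /andP[]] := FP _ (Pst n).
exists x, y, r; split => //.
- by move=> n; have [_ _ _ /andP[]] := FP _ (Pst n).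
- by move=> n m /far[].
- move=> n m; case: (ltngtP n m) => [/far[_ H _]|/far[_ _]|->].
  + by apply: le_trans H; rewrite lerDl ltW.
  + by rewrite metric_sym.
  + by have [_ _ _ /andP[]] := FP _ (Pst m).
Qed.

Let infinite_point (Z : set M) : infinite_set Z -> exists z, Z z.
Proof. by move=> /infinite_setN0. Qed.

(** Either some infinite subset is uniformly scattered, and its points can be
    selected one after the other with constant radii; or every infinite subset
    contains infinite subsets of arbitrarily small diameter, and the
    construction zooms in. In the second case the next set may accumulate at a
    point already considered, and choosing among three points leaves a pair away
    from it. *)
Lemma bump_sequence_exists (Delta : R) :
  (forall x y : M, mdist x y <= Delta) -> infinite_set [set: M] ->
  exists x y r K, bump_sequence x y r K.
Proof.
move=> bnd infM.
pose ball z e : set M := [set x | mdist z x < e].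
have [[Z0 [e [e0 [infZ0 fin]]]]|noA] := pselect (exists Z0 e, 0 < e /\
    (infinite_set Z0 /\ forall z, Z0 z -> finite_set (Z0 `&` ball z e))).
  pose P Z beta := [/\ infinite_set Z, Z `<=` Z0 & beta = e / 2].
  have e20 : 0 < e / 2 by rewrite divr_gt0.
  have shrink Z z : infinite_set Z -> Z `<=` Z0 -> Z z ->
      infinite_set (Z `\` ball z e).
    move=> iZ ZZ0 Zz finD; apply: iZ.
    have finI : finite_set (Z `&` ball z e).
      by apply: sub_finite_set (fin _ (ZZ0 _ Zz)); exact: setSI.
    by rewrite -(setUIDK Z (ball z e)) finite_setU.
  have [x [y [r H]]] : exists x y r, bump_sequence x y r (2 * Delta / e).
    apply: (@bump_sequence_greedy P _ Z0 (e / 2)); first by split.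
    move=> Z _ [iZ ZZ0 ->].
    have [x Zx] := infinite_point iZ.
    have i1 := shrink _ _ iZ ZZ0 Zx.
    have Z1Z0 : Z `\` ball x e `<=` Z0 by move=> ? [/ZZ0].
    have [y [Zy yx]] := infinite_point i1.
    have i2 := shrink _ _ i1 Z1Z0 (conj Zy yx).
    have farE u v : ~ ball u e v -> e <= mdist u v.
      by move=> /negP; rewrite -leNgt.
    have xy := farE _ _ yx.
    exists x, y, (e / 2), (Z `\` ball x e `\` ball y e), (e / 2); split => //.
    - by split=> // z [[]].
    - by rewrite e20 lexx.
    - rewrite (_ : 2 * Delta / e * (e / 2) = Delta); last by field; lra.
      by rewrite bnd andbT; lra.
    - split; first by split=> // z [/Z1Z0].
      move=> z [[_ /farE xz] /farE yz]; split; lra.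
  by exists x, y, r, (2 * Delta / e).
have small Z e : infinite_set Z -> 0 < e ->
    exists2 z, Z z & infinite_set (Z `&` ball z e).
  move=> iZ e0; apply: contrapT => no; apply: noA; exists Z, e; split=> //.
  split=> // z Zz; apply: contrapT => inf; apply: no; by exists z.
have [x [y [r H]]] : exists x y r, bump_sequence x y r 8.
  apply: (@bump_sequence_greedy (fun Z beta => infinite_set Z /\ 0 < beta) _
    [set: M] 1); first by split.
  move=> Z beta [iZ beta0].
  have [z1 Zz1 i1] := small _ _ iZ beta0.
  have [u [Zu bu]] := infinite_point i1.
  have i1u : infinite_set ((Z `&` ball z1 beta) `\` [set u]).
    by apply: infinite_setD => //; exact: finite_set1.
  have [v [[Zv bv] /eqP vu]] := infinite_point i1u.
  have i1uv : infinite_set ((Z `&` ball z1 beta) `\` [set u] `\` [set v]).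
    by apply: infinite_setD => //; exact: finite_set1.
  have [t [[[Zt bt] /eqP tu] /eqP tv]] := infinite_point i1uv.
  pose eta := Num.min (mdist u v) (Num.min (mdist u t) (mdist v t)).
  have eta0 : 0 < eta.
    by rewrite !lt_min !mdist_gt0 eq_sym vu eq_sym tu eq_sym tv.
  have [euv eut evt] : [/\ eta <= mdist u v, eta <= mdist u t & eta <= mdist v t].
    by split; rewrite !ge_min lexx ?orbT.
  have eta8 : 0 < eta / 8 by rewrite divr_gt0.
  have [z2 [Zz2 bz2] i2] := small _ _ i1 eta8.
  (* at most one of the three points is within eta / 2 of z2 *)
  have [x [y [[Zx bx] [Zy By] xy [y2 yx2]]]] : exists x y,
      [/\ (Z `&` ball z1 beta) x, (Z `&` ball z1 beta) y, eta <= mdist x y &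
          eta / 2 <= mdist z2 y /\ mdist z2 y <= mdist z2 x].
    have T (a b c : M) := metric_triangle a b c.
    have ord a b : (Z `&` ball z1 beta) a -> (Z `&` ball z1 beta) b ->
        eta <= mdist a b -> eta / 2 <= mdist z2 a -> eta / 2 <= mdist z2 b ->
        exists x y, [/\ (Z `&` ball z1 beta) x, (Z `&` ball z1 beta) y,
          eta <= mdist x y &
          eta / 2 <= mdist z2 y /\ mdist z2 y <= mdist z2 x].
      move=> Za Zb ab a2 b2; case: (leP (mdist z2 b) (mdist z2 a)) => ?.
        by exists a, b.
      by exists b, a; split=> //; [rewrite metric_sym|split=> //; exact: ltW].
    have near2 a b : eta <= mdist a b -> mdist z2 a < eta / 2 ->
        eta / 2 <= mdist z2 b.
      move=> ab a2; have := T a z2 b; rewrite (metric_sym a z2); lra.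
    have [u2|u2] := leP (eta / 2) (mdist z2 u); last first.
      have v2 := near2 _ _ euv u2; have t2 := near2 _ _ eut u2.
      by apply: (ord v t).
    have [v2|v2] := leP (eta / 2) (mdist z2 v); first exact: (ord u v).
    by apply: (ord u t) => //; exact: near2 evt v2.
  exists x, y, (mdist x y / 8), (Z `&` ball z1 beta `&` ball z2 (eta / 8)),
    (Num.min beta (eta / 4)).
  have xy2 := metric_triangle x z2 y; rewrite (metric_sym x z2) in xy2.
  split=> //.
  - by split; [move=> z [[]]|rewrite ge_min lexx].
  - have := metric_triangle x z1 y; rewrite (metric_sym x z1).
    by move: bx By; rewrite /ball/= => ? ? ?; apply/andP; split; lra.
  - by apply/andP; split; [have := mdist_ge0 x y; lra|lra].
  - split; first by split=> //; rewrite lt_min beta0/= divr_gt0.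
    move=> z [_]; rewrite /ball/= => zz2.
    have b1 : Num.min beta (eta / 4) <= eta / 4 by rewrite ge_min lexx orbT.
    have t1 := metric_triangle z2 z x; have t2 := metric_triangle z2 z y.
    rewrite (metric_sym z x) in t1; rewrite (metric_sym z y) in t2.
    by split; lra.
by exists x, y, r, 8.
Qed.


End bump_sequence.

(** * Bump functions adapted to covers *)

Section bump_families.
Context {R : realType} (X : metricType R).

Record bump_family (n : nat) (rad lip : R) (psi : nat -> X -> R)
    (z : nat -> X) : Prop := BumpFamily {
  bump_ge0 : forall i x, 0 <= psi i x ;
  bump_le1 : forall i x, psi i x <= 1 ;
  bump_lip : forall i x y, `|psi i x - psi i y| <= lip * mdist x y ;
  bump_cover : forall x, exists i, psi i x = 1 ;
  bump_rad : forall i x, psi i x != 0 -> mdist x (z i) <= rad ;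
  bump_mult : forall x (s : seq nat), uniq s ->
    all (fun i => psi i x != 0) s -> (size s <= n.+1)%N }.

Lemma diam_le_mdist (A : set X) (k : R) x y :
  (diam A <= k%:E)%E -> A x -> A y -> mdist x y <= k.
Proof.
move=> dA Ax Ay; rewrite -lee_fin; apply: le_trans dA.
by apply: ereal_sup_ubound; exists (x, y).
Qed.

Lemma mdist_diam_le (A : set X) (k : R) :
  (forall x y, A x -> A y -> mdist x y <= k) -> (diam A <= k%:E)%E.
Proof.
by move=> dA; apply: ge_ereal_sup => _ [[x y] [/= Ax Ay] <-]; rewrite lee_fin dA.
Qed.

(** Separability makes the cover countable, as every point of a countable dense
    set has a ball meeting only finitely many of its members. *)
Lemma nagata_cover_countable n (s : R) (C : set (set X)) :
  0 < s -> separable_set [set: X] ->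
  (forall A : set X, (diam A <= s%:E)%E ->
    ([set B | C B /\ A `&` B !=set0] #<= `I_n.+1)%card) ->
  countable [set B | C B /\ B !=set0].
Proof.
move=> s0 [D [cD _ dD]] mult.
pose near u := [set B | C B /\ [set y : X | mdist u y < s / 2] `&` B !=set0].
have cnear : countable (\bigcup_(u in D) near u).
  apply: bigcup_countable => // u Du; apply: finite_set_countable.
  apply: card_le_finite (finite_II n.+1); apply: mult.
  apply: mdist_diam_le => x y /= ux uy.
  have := metric_triangle x u y; rewrite (metric_sym x u); lra.
apply: sub_countable cnear; apply: subset_card_le => B [CB [b Bb]].
have s20 : 0 < s / 2 by rewrite divr_gt0.
have [u [Du]] := dD b I _ (nbhsx_ballx b _ s20).
rewrite ballEmdist/= => bu; exists u => //; split=> //; exists b.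
by split=> //=; rewrite metric_sym.
Qed.

(** The [i]-th function is the supremum over the [i]-th member of the cover of
    the cones [1 - 2 * mdist x b / s]. The functions that are nonzero at [x]
    belong to the members of the cover that meet the ball of center [x] and
    radius [s / 2], a set of diameter at most [s]. *)
Lemma nagata_bump_family n gamma (q : X) (s : R) : 0 < s ->
  nagata_dim_with X n gamma -> separable_set [set: X] ->
  exists psi z, bump_family n ((`|gamma| + 1) * s) (2 / s) psi z.
Proof.
move=> s0 nag sep; have [C [Ccov Cdiam Cmult]] := nag s s0.
have /countable_injP[e einj] := nagata_cover_countable s0 sep Cmult.
pose B i := [set x | exists A, [/\ C A, A x & e A = i]].
have s2 : 0 < 2 / s by rewrite divr_gt0.
have Beq i x y A A' : C A -> A x -> e A = i -> C A' -> A' y -> e A' = i ->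
    A = A'.
  move=> CA Ax Ai CA' Ay Ai'; apply: einj; last by rewrite Ai.
    by apply/mem_set; split=> //; exists x.
  by apply/mem_set; split=> //; exists y.
pose g (x b : X) : R := Num.max 0 (1 - 2 / s * mdist x b).
have g1 x b : g x b <= 1.
  by rewrite /g ge_max ler01/= gerBl mulr_ge0 ?mdist_ge0// ltW.
have g0 x b : 0 <= g x b by rewrite /g le_max lexx.
have glip x y b : g x b <= 2 / s * mdist x y + g y b.
  have t := ler_wpM2l (ltW s2) (metric_triangle y x b).
  have d0 : 0 <= 2 / s * mdist x y by rewrite mulr_ge0 ?mdist_ge0// ltW.
  rewrite mulrDr (metric_sym y x) in t.
  rewrite /g /Num.max; case: ifP => ?; case: ifP => ?; lra.
pose psi i x := sup [set g x b | b in B i].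
have psi_ge i x b : B i b -> g x b <= psi i x.
  move=> Bb; apply: ub_le_sup; last by exists b.
  by exists 1 => _ [? _ <-].
have psi_le i x c : 0 <= c -> (forall b, B i b -> g x b <= c) -> psi i x <= c.
  move=> c0 gc; rewrite /psi; set S := [set _ | _ in _].
  have [->|/set0P S0] := eqVneq S set0; first by rewrite sup0.
  by apply: ge_sup => // _ [b Bb <-]; exact: gc.
have psi0 i x : 0 <= psi i x.
  have [E|/set0P[b Bb]] := eqVneq (B i) set0.
    by rewrite /psi E image_set0 sup0.
  exact: le_trans (g0 x b) (psi_ge _ _ _ Bb).
have psi1 i x : psi i x <= 1 by exact: psi_le.
have psi_near i x : psi i x != 0 -> exists2 b, B i b & mdist x b < s / 2.
  move=> p0; apply: contrapT => no.
  have : psi i x <= 0.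
    apply: psi_le => // b Bb; rewrite /g ge_max lexx/= subr_le0.
    have [lt|] := ltP (mdist x b) (s / 2); first by exfalso; apply: no; exists b.
    by rewrite -ler_pdivrMl// invf_div mulr1.
  by move=> le; move: p0; rewrite eq_le le psi0.
pose z i := xget q (B i).
exists psi, z; split => //.
- move=> i x y; rewrite ler_norml.
  have h u v : psi i u <= 2 / s * mdist u v + psi i v.
    apply: psi_le => [|b Bb].
      by rewrite addr_ge0// mulr_ge0 ?mdist_ge0// ltW.
    by rewrite (le_trans (glip u v b))// lerD2l psi_ge.
  have h1 := h x y; have h2 := h y x; rewrite (metric_sym y x) in h2.
  by apply/andP; split; lra.
- move=> x; have [A CA Ax] : (\bigcup_(A in C) A) x by rewrite Ccov.
  exists (e A); apply/eqP; rewrite eq_le psi1/=.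
  apply: (le_trans _ (@psi_ge (e A) x x _)); last by exists A.
  by rewrite /g mdistxx mulr0 subr0 le_max lexx orbT.
- move=> i x /psi_near[b Bb xb].
  have Bz : B i (z i) by rewrite /z; apply: xgetPex; exists b.
  have [A [CA Ab Ai]] := Bb; have [A' [CA' Az Ai']] := Bz.
  have AA' := Beq _ _ _ _ _ CA Ab Ai CA' Az Ai'; rewrite -AA' in Az.
  have bz := diam_le_mdist (Cdiam _ CA) Ab Az.
  have ng : gamma * s <= `|gamma| * s by rewrite ler_wpM2r ?ler_norm// ltW.
  have := metric_triangle x b (z i); rewrite mulrDl mul1r; lra.
- move=> x l ul /allP lpsi.
  set A := [set y : X | mdist x y < s / 2].
  have dA : (diam A <= s%:E)%E.
    apply: mdist_diam_le => u v; rewrite /A/= => xu xv.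
    by have := metric_triangle u x v; rewrite (metric_sym u x); lra.
  have /pcard_leP[h] := Cmult A dA.
  pose M i := xget set0 [set A' | (C A' /\ A `&` A' !=set0) /\ e A' = i].
  have MP i : i \in l -> (C (M i) /\ A `&` M i !=set0) /\ e (M i) = i.
    move=> /lpsi /psi_near[b [A' [CA' A'b A'i]] xb].
    rewrite /M; case: xgetP => [A'' _ //|/(_ A')[]]; split=> //; split=> //.
    by exists b.
  have inj : {in l &, injective (fun i => h (M i))}.
    move=> i j il jl /= hij; have [Mi ei] := MP i il; have [Mj ej] := MP j jl.
    by rewrite -ei -ej; congr e; apply: (@inj _ _ _ h) => //; apply/mem_set.
  have : (size [seq h (M i) | i <- l] <= size (iota 0 n.+1))%N; last first.
    by rewrite size_map size_iota.
  apply: uniq_leq_size; first by rewrite map_inj_in_uniq.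
  move=> _ /mapP[i /MP[Mi _] ->]; rewrite mem_iota/= add0n.
  by have := @funS _ _ _ _ h _ Mi.
Qed.

End bump_families.

(** * Scales adapted to a distortion function *)

Section scales.
Context {R : realType}.

Lemma sum_halving_below (T : R) N (a : R) : 0 <= T -> 0 <= a ->
  \sum_(k < N) (if a / 2 ^+ k <= T then a / 2 ^+ k else 0) <= 2 * T.
Proof.
move=> T0; elim: N a => [|N IH] a a0; first by rewrite big_ord0 mulr_ge0.
have [aT|aT] := leP a T.
  apply: (@le_trans _ _ (\sum_(k < N.+1) a / 2 ^+ k)).
    by apply: ler_sum => k _; case: ifP => // _; rewrite divr_ge0// exprn_ge0.
  apply: (le_trans (sum_geometric_le _ a0)).
  have : 0 <= 2 * a / 2 ^+ N.+1 by rewrite divr_ge0 ?mulr_ge0 ?exprn_ge0.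
  lra.
rewrite big_ord_recl/= expr0 divr1 [a <= T]leNgt aT/= add0r.
have a20 : 0 <= a / 2 by rewrite divr_ge0.
apply: le_trans (IH _ a20); rewrite le_eqVlt; apply/orP; left; apply/eqP.
by apply: eq_bigr => k _; rewrite /bump/= add1n exprS invfM mulrA.
Qed.

Lemma sum_increasing_geometric (b beta : R) N : 0 <= b -> 1 < beta ->
  \sum_(k < N.+1) b * beta ^+ k <= beta / (beta - 1) * (b * beta ^+ N).
Proof.
move=> b0 beta1; have bm : 0 < beta - 1 by rewrite subr_gt0.
have c1 : 1 <= beta / (beta - 1) by rewrite ler_pdivlMr// mul1r gerBl.
elim: N => [|N IH]; first by rewrite big_ord1 expr0 ler_peMl// mulr1.
rewrite big_ord_recr/=; apply: (le_trans (lerD IH (lexx _))).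
rewrite exprS le_eqVlt; apply/orP; left; apply/eqP; field.
by rewrite gt_eqF.
Qed.

Lemma sum_geometric_below1 (b beta : R) N : 0 <= b -> 1 < beta ->
  \sum_(k < N) (if b * beta ^+ k <= 1 then b * beta ^+ k else 0)
    <= beta / (beta - 1).
Proof.
move=> b0 beta1; have bm : 0 < beta - 1 by rewrite subr_gt0.
have c0 : 0 <= beta / (beta - 1) by rewrite divr_ge0 ?ltW//; lra.
elim: N => [|N IH]; first by rewrite big_ord0.
have [b1|b1] := leP (b * beta ^+ N) 1; last first.
  by rewrite big_ord_recr/= [_ <= 1]leNgt b1/= addr0.
have e0 k : 0 <= b * beta ^+ k by rewrite mulr_ge0// exprn_ge0//; lra.
apply: (@le_trans _ _ (\sum_(k < N.+1) b * beta ^+ k)).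
  by apply: ler_sum => k _; case: ifP.
apply: (le_trans (sum_increasing_geometric _ b0 beta1)).
by rewrite ler_piMr.
Qed.

Variable w : distortion R.

Let concave_w a x : 0 <= a <= 1 -> 0 <= x -> a * w x <= w (a * x).
Proof.
move=> a01 x0; have /concave_onP /(_ a x 0 a01) := dfun_concave w.
by rewrite /= !in_itv/= !andbT dfun0 !mulr0 !addr0; apply.
Qed.

Lemma distortion_dilation c t : 1 <= c -> 0 <= t -> w (c * t) <= c * w t.
Proof.
move=> c1 t0; have c0 : 0 < c by lra.
have a01 : 0 <= c^-1 <= 1 by rewrite invr_ge0 ltW//= invf_le1.
have := concave_w a01 (mulr_ge0 (ltW c0) t0).
by rewrite mulKf ?gt_eqF// ler_pdivrMl.
Qed.

Lemma distortion_scales (Delta : R) : 0 < Delta ->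
  exists s : nat -> R, (forall k, 0 < s k) /\
    forall k, w (s k) = w Delta / 2 ^+ k.
Proof.
move=> D0; have w0 := dfun_gt0 w D0.
have : forall k : nat, exists sk, 0 < sk /\ w sk = w Delta / 2 ^+ k.
  move=> k; have v0 : 0 < w Delta / 2 ^+ k by rewrite divr_gt0// exprn_gt0.
  have vD : w Delta / 2 ^+ k <= w Delta.
    by rewrite ler_pdivrMr ?exprn_gt0// ler_peMr ?(ltW w0)// exprn_ege1// ler1n.
  have ct : {within `[0, Delta], continuous (dfun w)}.
    apply: continuous_subspaceW (@dfun_continuous _ w) => x /=.
    by rewrite !in_itv/= andbT => /andP[].
  have [|c] := @IVT _ w 0 Delta (w Delta / 2 ^+ k) (ltW D0) ct.
    by rewrite dfun0 (min_idPl (ltW w0)) (max_idPr (ltW w0)) (ltW v0) vD.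
  rewrite in_itv/= => /andP[c0 _] wc; exists c; split=> //.
  rewrite lt_neqAle c0 andbT; apply: contraTneq v0 => c0'.
  by rewrite -wc -c0' dfun0 ltxx.
by move=> /choice[s sP]; exists s; split=> k; have [] := sP k.
Qed.

Variables (p : R) (p_gt1 : 1 < p) (w_concave : p_concave p w).

Lemma p_concave_ratio r s : 0 <= r -> 0 < s -> r <= s ->
  r / s * w s `^ p <= w r `^ p.
Proof.
move=> r0 s0 rs.
have a01 : 0 <= r / s <= 1.
  by rewrite divr_ge0 ?(ltW s0)//= ler_pdivrMr// mul1r.
have /concave_onP /(_ (r / s) s 0 a01) := w_concave.
rewrite /= !in_itv/= lexx (ltW s0) => /(_ isT isT).
rewrite dfun0 powR0; last by rewrite gt_eqF// (lt_trans ltr01 p_gt1).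
by rewrite !mulr0 !addr0 divfK// gt_eqF.
Qed.

(** Where [w (s k) <= w r] the terms are at most [w (s k)], a decreasing
    geometric sequence. Elsewhere [r <= s k], so [p]-concavity gives
    [r / s k <= (w r / w (s k)) `^ p]; the terms are then at most
    [w r * (w r / w (s k)) `^ (p - 1)], an increasing geometric sequence because
    [p - 1 > 0], and it stays below [w r]. *)
Lemma sum_scales_le (w0 : R) (s : nat -> R) : 0 < w0 ->
  (forall k, 0 < s k) -> (forall k, w (s k) = w0 / 2 ^+ k) ->
  exists2 K, 0 <= K & forall N r, 0 <= r ->
    \sum_(k < N) w0 / 2 ^+ k * Num.min 1 (r / s k) <= K * w r.
Proof.
move=> w00 s0 ws.
pose beta : R := 2 `^ (p - 1).
have p10 : 0 < p - 1 by rewrite subr_gt0.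
have beta1 : 1 < beta.
  have := @gt0_ltr_powR R (p - 1) p10 1 2; rewrite powR1; apply.
  - by rewrite nnegrE.
  - by rewrite nnegrE.
  - by rewrite ltr1n.
have c0 : 0 <= beta / (beta - 1) by rewrite divr_ge0//; lra.
exists (2 + beta / (beta - 1)); first by rewrite addr_ge0.
move=> N r; rewrite le_eqVlt => /orP[/eqP <-|r0].
  rewrite dfun0 mulr0 big1// => k _.
  by rewrite mul0r (min_idPr _)// mulr0.
have W0 := dfun_gt0 w r0; set W := w r in W0 *.
have wk0 k : 0 < w0 / 2 ^+ k by rewrite divr_gt0// exprn_gt0.
pose B0 := W `^ (p - 1) / w0 `^ (p - 1).
have B00 : 0 <= B0 by rewrite divr_ge0// powR_ge0.
have wp k : (w0 / 2 ^+ k) `^ (p - 1) * beta ^+ k = w0 `^ (p - 1).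
  have -> : beta ^+ k = (2 ^+ k) `^ (p - 1).
    by rewrite -powR_mulrn ?powR_ge0// powRAC powR_mulrn.
  by rewrite -powRM ?divfK ?expf_neq0// ?exprn_ge0// ltW.
have Bk k : B0 * beta ^+ k = W `^ (p - 1) / (w0 / 2 ^+ k) `^ (p - 1).
  rewrite /B0 -(wp k) invfM mulrA -mulrA mulVf ?mulr1//.
  by rewrite expf_neq0// gt_eqF//; lra.
apply: (@le_trans _ _ (\sum_(k < N)
   ((if w0 / 2 ^+ k <= W then w0 / 2 ^+ k else 0) +
    W * (if B0 * beta ^+ k <= 1 then B0 * beta ^+ k else 0)))); last first.
  rewrite big_split/= -mulr_sumr mulrDl; apply: lerD.
    by apply: sum_halving_below; exact: ltW.
  rewrite [leRHS]mulrC ler_wpM2l ?(ltW W0)//.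
  exact: sum_geometric_below1.
apply: ler_sum => k _; have [wW|Ww] := leP (w0 / 2 ^+ k) W.
  apply: (@le_trans _ _ (w0 / 2 ^+ k)).
    by rewrite ler_piMr ?(ltW (wk0 k))// ge_min lexx.
  rewrite lerDl mulr_ge0 ?(ltW W0)//; case: ifP => // _.
  by rewrite mulr_ge0// exprn_ge0//; lra.
rewrite add0r.
have rs : r <= s k.
  rewrite leNgt; apply/negP => /ltW /(distortion_nondecreasing w (ltW (s0 k))).
  by rewrite ws -/W leNgt Ww.
have wkp : 0 < (w0 / 2 ^+ k) `^ (p - 1) by exact: powR_gt0.
have -> : B0 * beta ^+ k <= 1.
  rewrite Bk ler_pdivrMr// mul1r.
  by apply: ge0_ler_powR; rewrite ?nnegrE; apply: ltW.
apply: (@le_trans _ _ (w0 / 2 ^+ k * (r / s k))).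
  by rewrite ler_wpM2l ?(ltW (wk0 k))// ge_min lexx orbT.
rewrite Bk mulrA ler_pdivlMr//.
rewrite mulrC mulrA [_ * (w0 / _)]mulrC mulr_powRB1 ?(ltW (wk0 k))//; last lra.
rewrite mulr_powRB1 ?(ltW W0)//; last lra.
by rewrite mulrC -ws p_concave_ratio// ltW.
Qed.

End scales.

Section multiscale.
Context {R : realType} (X : metricType R) (w : distortion R).

(** The families [psi k] live at the scale at which [w] is about [w0 / 2 ^+ k].
    Level [0] belongs to the trivial cover, so that the telescoping sums and the
    words of labels below start from a constant. *)
Record multiscale (n : nat) (w0 K : R) (psi : nat -> nat -> X -> R)
    (z : nat -> nat -> X) (rad lip : nat -> R) : Prop := Multiscale {
  ms_w0 : 0 < w0 ;
  ms_K : 0 <= K ;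
  ms_family : forall k, bump_family n (rad k) (lip k) (psi k) (z k) ;
  ms_rad : forall k, w (rad k) <= K * (w0 / 2 ^+ k) ;
  ms_level0 : forall i x, psi 0%N i x = (i == 0%N)%:R ;
  ms_sum : forall N (x y : X),
    \sum_(k < N) w0 / 2 ^+ k * Num.min 1 (lip k * mdist x y)
      <= K * w (mdist x y) }.

Lemma bounded_space_mdist : bounded_space X ->
  exists2 Delta : R, 0 < Delta & forall x y : X, mdist x y <= Delta.
Proof.
rewrite /bounded_space; case E : (diam _) => [d||] // _.
  exists (Num.max d 1) => [|x y]; first by rewrite lt_max ltr01 orbT.
  rewrite le_max; apply/orP; left.
  by apply: (@diam_le_mdist R X setT) => //; rewrite E.
exists 1 => // x y; apply: (@diam_le_mdist R X setT) => //; rewrite E.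
exact: leNye.
Qed.

Lemma multiscale_exists (p : R) (q : X) : 1 < p -> p_concave p w ->
  bounded_space X -> separable_set [set: X] -> finite_nagata_dim X ->
  exists n w0 K psi z rad lip, multiscale n w0 K psi z rad lip.
Proof.
move=> p1 wp bX sX [n [gamma nag]].
have [Delta D0 dD] := bounded_space_mdist bX.
have [s [s0 ws]] := distortion_scales w D0.
have w00 := dfun_gt0 w D0; set w0 := w Delta in ws w00.
have [K1 K10 sumK] := sum_scales_le p1 wp w00 s0 ws.
have fam k : exists o : (nat -> X -> R) * (nat -> X),
    bump_family n ((`|gamma| + 1) * s k) (2 / s k) o.1 o.2.
  have [psi [z H]] := nagata_bump_family q (s0 k) nag sX.
  by exists (psi, z).
have [F FP] := choice fam.
pose K := Num.max (2 * K1) (`|gamma| + 1).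
have Kg : `|gamma| + 1 <= K by rewrite le_max lexx orbT.
have g1 : 1 <= `|gamma| + 1 by rewrite lerDr.
pose psi k := if k is 0%N then (fun i x => (i == 0%N)%:R) else (F k).1.
pose z k := if k is 0%N then (fun i => q) else (F k).2.
pose rad k := if k is 0%N then Delta else (`|gamma| + 1) * s k.
exists n, w0, K, psi, z, rad, (fun k => 2 / s k).
split => //.
- by apply: le_trans Kg; lra.
- case=> [|k]; last exact: FP.
  split => /=.
  + by move=> i x; rewrite ler0n.
  + by move=> i x; case: (i == 0%N).
  + move=> i x y; rewrite subrr normr0 mulr_ge0 ?mdist_ge0//.
    by rewrite divr_ge0// ltW.
  + by move=> x; exists 0%N.
  + by move=> i x _; exact: dD.
  + move=> x [|i [|j l]] //= /andP[]; rewrite inE negb_or => /andP[ij _] _.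
    rewrite !pnatr_eq0 !eqb0 !negbK => /and3P[/eqP i0 /eqP j0 _].
    by move: ij; rewrite i0 j0.
- case=> [|k] /=; first by rewrite expr0 divr1 ler_peMl ?(ltW w00)//; lra.
  apply: (le_trans (distortion_dilation w g1 (ltW (s0 _)))).
  by rewrite ws ler_wpM2r// divr_ge0 ?exprn_ge0// ltW.
- move=> N x y; apply: (@le_trans _ _ (2 * (K1 * w (mdist x y)))); last first.
    rewrite mulrA ler_wpM2r ?distortion_ge0 ?mdist_ge0//.
    by rewrite le_max lexx.
  apply: (le_trans _ (ler_wpM2l _ (sumK N _ (mdist_ge0 x y)))) => //.
  rewrite mulr_sumr; apply: ler_sum => k _.
  rewrite mulrCA ler_wpM2l ?divr_ge0 ?exprn_ge0 ?(ltW w00)//.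
  rewrite (_ : 2 / s k * mdist x y = 2 * (mdist x y / s k)); last first.
    by rewrite -mulrA [_^-1 * _]mulrC.
  set t := mdist x y / s k.
  have t0 : 0 <= t by rewrite divr_ge0 ?mdist_ge0// ltW.
  by rewrite /Num.min; case: ifP => ?; case: ifP => ?; lra.
Qed.

End multiscale.

(** * Factoring the identity of the free space through l1 *)

Section partition_of_unity.
Context {R : realType} (X : metricType R).
Variables (n : nat) (rad lip : R) (psi : nat -> X -> R) (z : nat -> X).
Hypothesis fam : bump_family n rad lip psi z.

Fixpoint envelope (i : nat) (x : X) : R :=
  if i is j.+1 then Num.max (envelope j x) (psi j x) else 0.

(** The part of the [i]-th bump that exceeds the previous ones: these functions
    sum to the supremum of the bumps, which is [1]. *)
Definition pou (i : nat) (x : X) : R := envelope i.+1 x - envelope i x.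

Lemma envelope_le1 i x : 0 <= envelope i x <= 1.
Proof.
elim: i => [|i /andP[IH0 IH1]] /=; first by rewrite lexx ler01.
by rewrite le_max IH0/= ge_max IH1 (bump_le1 fam).
Qed.

Lemma pou_ge0 i x : 0 <= pou i x.
Proof. by rewrite subr_ge0 /= le_max lexx. Qed.

Lemma sum_pou i x : \sum_(j < i) pou j x = envelope i x.
Proof.
elim: i => [|i IH]; first by rewrite big_ord0.
by rewrite big_ord_recr/= IH /pou addrC subrK.
Qed.

Lemma pou_neq0 i x : pou i x != 0 -> psi i x != 0.
Proof.
apply: contra_neq => p0; rewrite /pou /= p0 (max_idPl _) ?subrr//.
by have /andP[] := envelope_le1 i x.
Qed.

Lemma pou_eventually x :
  exists I, \sum_(j < I) pou j x = 1 /\ forall i, (I <= i)%N -> pou i x = 0.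
Proof.
have [i pi] := bump_cover fam x.
have one k : envelope (i.+1 + k) x = 1.
  elim: k => [|k IH]; last first.
    rewrite addnS -[LHS]/(Num.max (envelope (i.+1 + k) x) (psi (i.+1 + k) x)).
    by rewrite IH (max_idPl _)// (bump_le1 fam).
  rewrite addn0 /= pi (max_idPr _)//.
  by have /andP[] := envelope_le1 i x.
exists i.+1; split; first by rewrite sum_pou -(addn0 i.+1) one.
move=> j ij; rewrite /pou; have := one (j - i.+1)%N; have := one (j.+1 - i.+1)%N.
by rewrite !subnKC// => [-> ->|]; rewrite ?subrr// (leq_trans ij).
Qed.

Lemma envelope_lip i x y :
  `|envelope i x - envelope i y| <= lip * mdist x y.
Proof.
elim: i => [|i] /=.
  by rewrite subrr normr0; apply: le_trans (bump_lip fam 0 x y).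
have := bump_lip fam i x y; rewrite !ler_norml => /andP[? ?] /andP[? ?].
rewrite /Num.max; case: ifP => ?; case: ifP => ?; apply/andP; split; lra.
Qed.

Lemma sum_pou_lip N x y : \sum_(j < N) `|pou j x - pou j y| <=
  4 * n.+1%:R * Num.min 1 (lip * mdist x y).
Proof.
have n1 : 1 <= n.+1%:R :> R by rewrite ler1n.
rewrite /Num.min; case: ifP => _.
  rewrite mulr1; apply: (@le_trans _ _ (\sum_(j < N) (pou j x + pou j y))).
    apply: ler_sum => j _; apply: (le_trans (ler_normB _ _)).
    by rewrite !ger0_norm ?pou_ge0.
  rewrite big_split/= !sum_pou.
  have /andP[_ ?] := envelope_le1 N x; have /andP[_ ?] := envelope_le1 N y; lra.
have -> : 4 * n.+1%:R * (lip * mdist x y) =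
  2 * n.+1%:R * (2 * lip * mdist x y) by ring.
apply: sum_lipschitz_multiplicity.
  move=> c u v; rewrite /pou.
  rewrite (_ : _ - _ - _ = (envelope c.+1 u - envelope c.+1 v) -
    (envelope c u - envelope c v)); last by ring.
  rewrite (le_trans (ler_normB _ _))// -mulrA mulrDl mul1r.
  by rewrite lerD// envelope_lip.
move=> u s us su; apply: (bump_mult fam (x := u)) => //.
by apply: sub_all su => i; exact: pou_neq0.
Qed.

End partition_of_unity.

Section product_increments.
Context {R : realType}.

Lemma sum_product_increments (a a' b b' : nat -> R) I J (A B : R) :
  (forall i, 0 <= a' i) -> (forall j, 0 <= b j) ->
  \sum_(i < I) a' i <= 1 -> \sum_(j < J) b j <= 1 ->
  \sum_(i < I) `|a i - a' i| <= A -> \sum_(j < J) `|b j - b' j| <= B ->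
  \sum_(i < I) \sum_(j < J) `|a i * b j - a' i * b' j| <= A + B.
Proof.
move=> a0 b0 a1 b1 aA bB.
have B0 : 0 <= B by apply: le_trans bB; exact: sumr_ge0.
have A0 : 0 <= A by apply: le_trans aA; exact: sumr_ge0.
apply: (@le_trans _ _ (\sum_(i < I) (`|a i - a' i| + a' i * B))).
  apply: ler_sum => i _.
  apply: (@le_trans _ _ (\sum_(j < J) (`|a i - a' i| * b j +
      a' i * `|b j - b' j|))).
    apply: ler_sum => j _.
    rewrite (_ : _ - _ = (a i - a' i) * b j + a' i * (b j - b' j)); last by ring.
    rewrite (le_trans (ler_normD _ _))// !normrM (ger0_norm (b0 j)).
    by rewrite (ger0_norm (a0 i)).
  rewrite big_split/= -!mulr_sumr lerD ?ler_wpM2l//.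
  by rewrite ler_piMr.
rewrite big_split/= -mulr_suml lerD//.
by rewrite ler_piMl.
Qed.

End product_increments.

Section free_space_factorization.
Context {R : realType} (X : metricType R) (w : distortion R) (q : X).
Variables (n : nat) (w0 K : R) (psi : nat -> nat -> X -> R).
Variables (z : nat -> nat -> X) (rad lip : nat -> R).
Hypothesis ms : multiscale w n w0 K psi z rad lip.

Local Notation Y := (distorted w X).
Local Notation wt k := (w0 / 2 ^+ k).
Local Notation phi k := (pou (psi k)).

Let fam k := ms_family ms k.
Let K0 := ms_K ms.

Let wt_gt0 k : 0 < wt k.
Proof. by rewrite divr_gt0 ?(ms_w0 ms)// exprn_gt0. Qed.

Let wtS k : wt k = 2 * wt k.+1.
Proof.
have z0 : (2 : R) ^+ k != 0 by rewrite expf_neq0.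
by rewrite exprS; field.
Qed.

Let center_dist k i x : phi k i x != 0 ->
  @mdist R Y x (z k i) <= K * wt k.
Proof.
move=> /(pou_neq0 (fam k)) /(bump_rad (fam k)) xz.
rewrite mdist_distorted; apply: (le_trans _ (ms_rad ms k)).
by apply: distortion_nondecreasing => //; exact: mdist_ge0.
Qed.

(** A natural number codes a level [k], an index [i] at level [k.+1] and an index
    [j] at level [k]. *)
Definition level_of (c : nat) : nat := (unpair c).1.
Definition fine_of (c : nat) : nat := (unpair (unpair c).2).1.
Definition coarse_of (c : nat) : nat := (unpair (unpair c).2).2.

(* up to additive constants, the coordinates of the evaluation at x in l1 *)
Let weight (c : nat) (x : Y) : R := wt (level_of c) *
  (phi (level_of c).+1 (fine_of c) x * phi (level_of c) (coarse_of c) x).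

Let C : R := 3 * (4 * n.+1%:R * K).

Let C0 : 0 <= C. Proof. by rewrite !mulr_ge0. Qed.

Let sum_weight N x y : \sum_(c < N) `|weight c x - weight c y|
  <= C * @mdist R Y x y.
Proof.
pose m k := 4 * n.+1%:R * Num.min 1 (lip k * @mdist R X x y).
pose g k l := `|wt k * (phi k.+1 (unpair l).1 x * phi k (unpair l).2 x) -
                wt k * (phi k.+1 (unpair l).1 y * phi k (unpair l).2 y)|.
apply: (@sum_unpair_le _ g) => // [k l|N' L]; first exact: normr_ge0.
have mle M : \sum_(k < M) wt k * m k <= 4 * n.+1%:R * K * @mdist R Y x y.
  under eq_bigr do rewrite /m mulrCA.
  rewrite -mulr_sumr -mulrA ler_wpM2l ?mulr_ge0//.
  exact: (ms_sum ms).
have m0 k : 0 <= m k.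
  rewrite /m mulr_ge0 ?mulr_ge0// le_min ler01/=.
  exact: le_trans (bump_lip (fam k) 0 x y).
have row k : \sum_(l < L) g k l <= wt k * (m k.+1 + m k).
  rewrite /g; under eq_bigr do rewrite -mulrBr normrM (gtr0_norm (wt_gt0 _)).
  rewrite -mulr_sumr ler_wpM2l ?(ltW (wt_gt0 _))//.
  apply: (@sum_unpair_le _ (fun i j => `|phi k.+1 i x * phi k j x -
    phi k.+1 i y * phi k j y|)) => // I J.
  have pou1 k' u M : \sum_(i < M) phi k' i u <= 1.
    by rewrite sum_pou; have /andP[] := envelope_le1 (fam k') M u.
  apply: (@sum_product_increments R (fun i => phi k.+1 i x)
    (fun i => phi k.+1 i y) (fun j => phi k j x) (fun j => phi k j y)) => //.
  - by move=> i; exact: pou_ge0.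
  - by move=> j; exact: pou_ge0.
  - exact: (sum_pou_lip (fam k.+1)).
  - exact: (sum_pou_lip (fam k)).
apply: (@le_trans _ _ (\sum_(k < N') wt k * (m k.+1 + m k))).
  by apply: ler_sum => k _; exact: row.
under eq_bigr do rewrite mulrDr {1}wtS -mulrA.
rewrite big_split/= -mulr_sumr.
have h1 := mle N'.
have h2 : \sum_(k < N') wt k.+1 * m k.+1 <= 4 * n.+1%:R * K * @mdist R Y x y.
  apply: le_trans (mle N'.+1); rewrite big_ord_recl/= lerDr.
  by rewrite mulr_ge0// ltW.
apply: (le_trans (lerD (ler_wpM2l (ler0n _ 2) h2) h1)).
by rewrite /C le_eqVlt; apply/orP; left; apply/eqP; ring.
Qed.

Let weight_lip c x y : `|weight c x - weight c y| <= C * @mdist R Y x y.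
Proof.
apply: le_trans (sum_weight c.+1 x y); rewrite big_ord_recr/= lerDr.
exact: sumr_ge0.
Qed.

Let weight_fun c : @Lip0 R Y q :=
  @mk_lip0 R Y q (weight c) C (weight_lip c).

Let sum_weight_fun N x y :
  \sum_(c < N) `|lip0_fun (weight_fun c) x - lip0_fun (weight_fun c) y|
    <= C * @mdist R Y x y.
Proof.
under eq_bigr do rewrite mk_lip0B.
exact: sum_weight.
Qed.

Let overlap c := exists x : Y, phi (level_of c).+1 (fine_of c) x != 0 /\
  phi (level_of c) (coarse_of c) x != 0.

Let jump c : @LF R Y q :=
  if `[< overlap c >] then
    (wt (level_of c))^-1 *: (@free_delta R Y q (z (level_of c).+1 (fine_of c)) -
      @free_delta R Y q (z (level_of c) (coarse_of c)))
  else 0.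

Let K20 : 0 <= 2 * K. Proof. by rewrite mulr_ge0. Qed.

Let jump_dist k i j x : phi k.+1 i x != 0 -> phi k j x != 0 ->
  @mdist R Y (z k.+1 i) (z k j) <= 2 * K * wt k.
Proof.
move=> /center_dist h1 /center_dist h2.
have := @metric_triangle R Y (z k.+1 i) x (z k j).
rewrite (@metric_sym R Y (z k.+1 i) x).
have : K * wt k.+1 <= K * wt k.
  by rewrite ler_wpM2l// (wtS k) ler_peMl ?(ltW (wt_gt0 _))//; lra.
lra.
Qed.

Let jump_norm c : `|jump c| <= 2 * K.
Proof.
rewrite /jump; case: asboolP => [[x [h1 h2]]|_]; last by rewrite normr0.
rewrite normrZ normfV gtr0_norm// mulrC ler_pdivrMr//.
exact: le_trans (molecule_norm_le _ _ _) (jump_dist h1 h2).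
Qed.

Section evaluation.
Variables (f : @Lip0 R Y q) (x : Y).

Let term k l : R := phi k.+1 (unpair l).1 x * phi k (unpair l).2 x *
  (lip0_fun f (z k.+1 (unpair l).1) - lip0_fun f (z k (unpair l).2)).

Let weight_jump c : weight c x * pairing (jump c) f =
  term (unpair c).1 (unpair c).2.
Proof.
rewrite /weight /jump /term -/(level_of c) -/(fine_of c) -/(coarse_of c).
case: asboolP => [_|no].
  rewrite -[_ *: _]addr0 pairing_linearl pairingBl !pairing_delta.
  have -> : pairing 0 f = 0 :> R by [].
  have := wt_gt0 (level_of c); move: (wt _) => W /lt0r_neq0 W0.
  by rewrite addr0; field.
have -> : phi (level_of c).+1 (fine_of c) x * phi (level_of c) (coarse_of c) x
    = 0.
  apply/eqP; rewrite mulf_eq0; apply: contrapT => /negP.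
  rewrite negb_or => /andP[h1 h2].
  by apply: no; exists x.
by rewrite mulr0 !mul0r.
Qed.

Let D : R := 2 * K * w0 * `|f|.
Let D0 : 0 <= D. Proof. by rewrite !mulr_ge0// ltW// (ms_w0 ms). Qed.

Let term_row k L : \sum_(l < L) `|term k l| <= D / 2 ^+ k.
Proof.
pose t i j := phi k.+1 i x * phi k j x *
  (lip0_fun f (z k.+1 i) - lip0_fun f (z k j)).
apply: (@sum_unpair_le _ (fun i j => `|t i j|)) => // I J.
have bnd i j : `|t i j| <= phi k.+1 i x * phi k j x * (D / 2 ^+ k).
  have [h|h] := eqVneq (phi k.+1 i x * phi k j x) 0.
    by rewrite /t h !mul0r normr0.
  rewrite /t normrM ger0_norm ?mulr_ge0 ?pou_ge0// ler_wpM2l ?mulr_ge0 ?pou_ge0//.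
  move: h; rewrite mulf_eq0 negb_or => /andP[h1 h2].
  apply: (le_trans (lip_normP f _ _)).
  rewrite (_ : D / 2 ^+ k = `|f| * (2 * K * wt k)); last by rewrite /D; ring.
  by rewrite ler_wpM2l ?best_constant_ge0//; exact: jump_dist h1 h2.
apply: (@le_trans _ _ (\sum_(i < I) \sum_(j < J)
    phi k.+1 i x * phi k j x * (D / 2 ^+ k))).
  by apply: ler_sum => i _; apply: ler_sum => j _; exact: bnd.
under eq_bigr do rewrite -mulr_suml -mulr_sumr.
rewrite -!mulr_suml !sum_pou.
have /andP[a0 a1] := envelope_le1 (fam k.+1) I x.
have /andP[b0 b1] := envelope_le1 (fam k) J x.
rewrite ler_piMl ?divr_ge0 ?exprn_ge0//.
by rewrite mulr_ile1.
Qed.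

Let last_index := projT1 (choice (fun k => pou_eventually (fam k) x)).

Let last_indexP k : \sum_(j < last_index k) phi k j x = 1 /\
  forall i, (last_index k <= i)%N -> phi k i x = 0.
Proof. exact: (projT2 (choice (fun k => pou_eventually (fam k) x)) k). Qed.

Let approx k : R := \sum_(i < last_index k) phi k i x * lip0_fun f (z k i).

Let sum_widen k (u : nat -> R) I : (last_index k <= I)%N ->
  \sum_(i < I) phi k i x * u i = \sum_(i < last_index k) phi k i x * u i.
Proof.
move=> kI; rewrite -!(big_mkord predT (fun i => phi k i x * u i)).
rewrite (big_cat_nat _ kI)//= [X in _ + X]big_nat_cond [X in _ + X]big1 ?addr0// => i.
by rewrite andbT => /andP[ki _]; rewrite (last_indexP k).2// mul0r.
Qed.

Let sum_widen1 k I : (last_index k <= I)%N -> \sum_(i < I) phi k i x = 1.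
Proof.
move=> kI; rewrite -(last_indexP k).1.
have := sum_widen (fun=> 1) kI.
by under eq_bigr do rewrite mulr1; under [in RHS]eq_bigr do rewrite mulr1.
Qed.

Let approx_dist k : `|approx k - lip0_fun f x| <= `|f| * (K * wt k).
Proof.
have -> : lip0_fun f x = \sum_(i < last_index k) phi k i x * lip0_fun f x.
  by rewrite -mulr_suml (last_indexP k).1 mul1r.
rewrite -sumrB; apply: (le_trans (ler_norm_sum _ _ _)).
apply: (@le_trans _ _ (\sum_(i < last_index k)
    phi k i x * (`|f| * (K * wt k)))); last first.
  by rewrite -mulr_suml (last_indexP k).1 mul1r.
apply: ler_sum => i _; rewrite -mulrBr normrM ger0_norm ?pou_ge0//.
have [->|h] := eqVneq (phi k i x) 0; first by rewrite !mul0r.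
rewrite ler_wpM2l ?pou_ge0//; apply: (le_trans (lip_normP f _ _)).
by rewrite ler_wpM2l ?best_constant_ge0// (@metric_sym R Y); exact: center_dist.
Qed.

Let approx0 : approx 0 = lip0_fun f (z 0 0).
Proof.
have phi0 i : phi 0 i.+1 x = 0.
  apply: contrapT => /eqP /(pou_neq0 (fam 0)).
  by rewrite (ms_level0 ms) eqxx.
rewrite /approx; case: (last_index 0) (last_indexP 0) => [|I] [].
  by rewrite big_ord0 => /eqP; rewrite eq_sym oner_eq0.
rewrite !big_ord_recl/= big1 => [|i _]; last by rewrite /bump/= add1n phi0.
rewrite addr0 => -> _; rewrite mul1r big1 ?addr0// => i _.
by rewrite /bump/= add1n phi0 mul0r.
Qed.

Let term_sum k : exists L0, forall L, (L0 <= L)%N ->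
  \sum_(l < L) term k l = approx k.+1 - approx k.
Proof.
pose I := maxn (last_index k.+1) (last_index k).
have [|L0 HL] := @sum_unpair_finite R (fun i j => phi k.+1 i x * phi k j x *
  (lip0_fun f (z k.+1 i) - lip0_fun f (z k j))) I.
  move=> i j; apply: contra_neqT; rewrite negb_and -!leqNgt /I !geq_max.
  move=> /orP[/andP[h _]|/andP[_ h]].
    by rewrite (last_indexP k.+1).2// !mul0r.
  by rewrite (last_indexP k).2// mulr0 mul0r.
exists L0 => L /HL ->.
have Ik1 : (last_index k.+1 <= I)%N by exact: leq_maxl.
have Ik : (last_index k <= I)%N by exact: leq_maxr.
transitivity (\sum_(i < I) phi k.+1 i x * (lip0_fun f (z k.+1 i) - approx k)).
  apply: eq_bigr => i _.
  rewrite /approx -(sum_widen (fun j => lip0_fun f (z k j)) Ik).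
  rewrite -[lip0_fun f (z k.+1 i) in RHS]mul1r -(sum_widen1 Ik) mulr_suml -sumrB.
  rewrite mulr_sumr; apply: eq_bigr => j _; ring.
under eq_bigr do rewrite mulrBr.
rewrite sumrB -mulr_suml sum_widen1// mul1r.
by rewrite (sum_widen (fun i => lip0_fun f (z k.+1 i)) Ik1).
Qed.

(** Level by level the terms sum to [approx k.+1 - approx k], and [approx k]
    tends to [lip0_fun f x] because [psi k i x] is nonzero only for centers
    [z k i] close to [x]. *)
Lemma sum_jumps_cvg : (fun N => \sum_(c < N) weight c x * pairing (jump c) f)
  @ \oo --> lip0_fun f x - lip0_fun f (z 0 0).
Proof.
pose E : R := 2 * D + `|f| * K * w0.
have E0 : 0 <= E.
  by rewrite addr_ge0 ?mulr_ge0// ltW// (ms_w0 ms).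
have bound k : exists N0, forall N, (N0 <= N)%N ->
    `|\sum_(c < N) weight c x * pairing (jump c) f -
      (lip0_fun f x - lip0_fun f (z 0 0))| <= E / 2 ^+ k.
  have [N0 HN] := sum_unpair_approx k D0 term_row term_sum.
  exists N0 => N /HN; under eq_bigr do rewrite -weight_jump.
  rewrite -(big_mkord predT (fun k => approx k.+1 - approx k)).
  rewrite telescope_sumr// approx0 => HN'.
  rewrite (_ : _ - (_ - _) = (\sum_(c < N) weight c x * pairing (jump c) f -
    (approx k - lip0_fun f (z 0 0))) + (approx k - lip0_fun f x)); last by ring.
  rewrite (le_trans (ler_normD _ _))// /E [leRHS]mulrDl lerD//.
  by rewrite -!mulrA; exact: approx_dist.
apply/cvgrPdist_le => e e0.
have h2 : `|2^-1 : R| < 1 by rewrite ger0_norm ?invr_ge0// invf_lt1// ltr1n.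
have /cvgrPdist_le /(_ e e0) [k _ /(_ k (leqnn k))] := cvg_geometric E h2.
rewrite /geometric/= sub0r normrN exprVn ger0_norm ?divr_ge0 ?exprn_ge0// => Ek.
have [N0 HN] := bound k; exists N0 => // N /= /HN; rewrite distrC => le.
exact: le_trans le Ek.
Qed.

End evaluation.

(** [A] takes the coordinates [weight] and [B] sends the basis vectors to the
    [jump]s; by density it is enough to check [B \o A] on the evaluations, where
    it is the telescoping sum. *)
Lemma free_space_factorization :
  exists (A : @LF R Y q -> ell1 R) (B : ell1 R -> @LF R Y q),
    [/\ bounded_linear A, bounded_linear B & forall m, B (A m) = m].
Proof.
pose A := analysis C0 sum_weight_fun; pose B := synthesis K20 jump_norm.
have blA : bounded_linear A by exact: bounded_linear_analysis.
have blB : bounded_linear B by exact: bounded_linear_synthesis.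
exists A, B; split => //.
apply: bounded_linear_delta_ext (bounded_linear_comp blB blA)
  (bounded_linear_id _) _ => x.
apply: LF_ext => f; rewrite pairing_delta.
rewrite -(cvg_lim (@Rhausdorff R) (@synthesis_cvg _ _ _ _ _ K20 jump_norm
  (A (@free_delta R Y q x)) f)).
apply: (cvg_lim (@Rhausdorff R)).
have -> : (fun N => \sum_(c < N) ell1_seq (A (@free_delta R Y q x)) c *
    pairing (jump c) f) =
  (fun N => \sum_(c < N) weight c x * pairing (jump c) f -
            \sum_(c < N) weight c q * pairing (jump c) f).
  apply/funext => N; rewrite -sumrB; apply: eq_bigr => c _.
  by rewrite analysisE pairing_delta mk_lip0E mulrBl.
rewrite (_ : lip0_fun f x = (lip0_fun f x - lip0_fun f (z 0%N 0%N)) -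
  (lip0_fun f q - lip0_fun f (z 0%N 0%N))); last by rewrite lip0_fun_base; ring.
by apply: cvgB; exact: sum_jumps_cvg.
Qed.

End free_space_factorization.

(** * The ultrametric space of infinite words *)

Section words.
Context (R : realType).

Definition words : Type := nat -> nat.

Definition word_dist (a b : words) : R :=
  sup [set (2 ^+ k)^-1 | k in [set k | a k != b k]].

Let inv2_gt0 k : 0 < (2 ^+ k)^-1 :> R.
Proof. by rewrite invr_gt0 exprn_gt0. Qed.

Let inv2_le1 k : (2 ^+ k)^-1 <= 1 :> R.
Proof. by rewrite invf_le1 ?exprn_gt0// exprn_ege1// ler1n. Qed.

Lemma word_dist_ge a b k : a k != b k -> (2 ^+ k)^-1 <= word_dist a b.
Proof.
move=> ab; apply: ub_le_sup; last by exists k.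
by exists 1 => _ [j _ <-].
Qed.

Lemma word_dist_le a b c : 0 <= c ->
  (forall k, a k != b k -> (2 ^+ k)^-1 <= c) -> word_dist a b <= c.
Proof.
move=> c0 abc; rewrite /word_dist; set S := [set _ | _ in _].
have [->|/set0P S0] := eqVneq S set0; first by rewrite sup0.
by apply: ge_sup => // _ [k ab <-]; exact: abc.
Qed.

Lemma word_dist_ge0 a b : 0 <= word_dist a b.
Proof.
have [->|/eqP ab] := pselect (a = b).
  rewrite /word_dist (_ : [set _ | _ in _] = set0) ?sup0// -subset0.
  by move=> y [k /=]; rewrite eqxx.
have [k abk] : exists k, a k != b k.
  apply: contrapT => /forallNP E; move/eqP: ab; apply; apply/funext => k.
  by have /negP/negPn/eqP := E k.
exact: le_trans (ltW (inv2_gt0 k)) (word_dist_ge abk).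
Qed.

Lemma word_dist_ultra a b c :
  word_dist a c <= Num.max (word_dist a b) (word_dist b c).
Proof.
apply: word_dist_le => [|k ac]; first by rewrite le_max word_dist_ge0.
rewrite le_max; have [ab|ab] := eqVneq (a k) (b k); last first.
  by rewrite word_dist_ge.
by rewrite (@word_dist_ge b c) ?orbT// -ab.
Qed.

Let word_distxx a : word_dist a a = 0.
Proof.
by apply/eqP; rewrite eq_le word_dist_ge0 word_dist_le// => k; rewrite eqxx.
Qed.

Let word_dist_positivity a b : word_dist a b = 0 -> a = b.
Proof.
move=> ab0; apply/funext => k; apply/eqP; apply: contrapT => /negP ab.
by have := word_dist_ge ab; rewrite ab0 leNgt inv2_gt0.
Qed.

Let word_dist_sym a b : word_dist a b = word_dist b a.
Proof.
by apply/eqP; rewrite eq_le; apply/andP; split; apply: word_dist_le;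
  rewrite ?word_dist_ge0// => k ab; apply: word_dist_ge; rewrite eq_sym.
Qed.

Let word_dist_triangle b a c : word_dist a c <= word_dist a b + word_dist b c.
Proof.
apply: (le_trans (word_dist_ultra a b c)).
by rewrite ge_max lerDl lerDr !word_dist_ge0.
Qed.

HB.instance Definition _ := gen_eqMixin words.
HB.instance Definition _ := gen_choiceMixin words.
HB.instance Definition _ := isMetric.Build R words
  word_distxx word_dist_positivity word_dist_sym word_dist_triangle.

Lemma mdist_words (a b : words) : mdist a b = word_dist a b.
Proof. by []. Qed.

Lemma words_bounded : bounded_space words.
Proof.
apply: (@le_lt_trans _ _ 1%:E); last exact: ltry.
apply: mdist_diam_le => a b _ _; rewrite mdist_words.
exact: word_dist_le.
Qed.

Lemma words_ultrametric : ultrametric words.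
Proof. by move=> a b c; exact: word_dist_ultra. Qed.

Lemma word_dist_prefix (a b : words) n :
  (forall k, (k < n)%N -> a k = b k) -> word_dist a b <= (2 ^+ n)^-1.
Proof.
move=> ab; apply: word_dist_le => [|k kab]; first exact: ltW.
rewrite lef_pV2 ?posrE ?exprn_gt0// ler_weXn2l ?ler1n//.
by rewrite leqNgt; apply/negP => /ab /eqP; rewrite (negbTE kab).
Qed.

Lemma ball_prefix (a : words) (e : R) : 0 < e ->
  exists n, forall b : words, (forall k, (k < n)%N -> b k = a k) -> ball a e b.
Proof.
move=> e0.
have h2 : `|2^-1 : R| < 1 by rewrite ger0_norm ?invr_ge0// invf_lt1// ltr1n.
have /cvgrPdist_lt /(_ e e0) [n _ /(_ n (leqnn n))] := cvg_geometric 1 h2.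
rewrite /geometric/= sub0r normrN exprVn mul1r ger0_norm ?ltW// => ne.
exists n => b ab; rewrite ballEmdist/= mdist_words.
by apply: le_lt_trans ne; apply: word_dist_prefix => k /ab ->.
Qed.

Lemma words_separable : separable_set [set: words].
Proof.
exists (range (fun s : seq nat => nth 0%N s : words)); split => //.
  apply: sub_countable (countableP [set: seq nat]); exact: card_image_le.
move=> a _ U /nbhs_ballP[e /= e0 eU]; have [n na] := ball_prefix a e0.
exists (nth 0%N (mkseq a n)); split; first by exists (mkseq a n).
by apply/eU/na => k kn; rewrite nth_mkseq.
Qed.

(** Open sets are countable unions of cylinders, and cylinders are finite
    intersections of conditions on one letter. *)
Lemma words_open_measurable d (T : measurableType d) (g : T -> words) :
  (forall k c, measurable [set t | g t k = c]) ->
  forall B, <<s [set U : set words | open U] >> B ->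
    measurable [set t | B (g t)].
Proof.
move=> mg; pose H := [set B : set words | measurable [set t | B (g t)]].
suff : <<s [set U : set words | open U] >> `<=` H by [].
apply: smallest_sub.
  split => [|A mA|A mA]; rewrite /H/=.
  - by rewrite (_ : [set t | _] = set0)// -subset0.
  - rewrite (_ : [set t | _] = ~` [set t | A (g t)]); first exact: measurableC.
    by apply/seteqP; split=> [t []|t].
  - rewrite (_ : [set t | _] = \bigcup_n [set t | A n (g t)]).
      by apply: bigcupT_measurable => n; exact: mA.
    by apply/seteqP; split=> t [n]; exists n.
move=> U oU; rewrite /H/=.
pose cyl (s : seq nat) :=
  [set a : words | forall k, (k < size s)%N -> a k = nth 0%N s k].
pose F s := if `[< cyl s `<=` U >] then [set t | cyl s (g t)] else set0.
have mcyl s : measurable [set t | cyl s (g t)].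
  rewrite (_ : [set t | _] = \bigcap_k (if (k < size s)%N then
    [set t | g t k = nth 0%N s k] else setT)).
    by apply: bigcapT_measurable => k; case: ifP.
  apply/seteqP; split=> [t tc k _|t tc k ks]; first by case: ifP => // /tc.
  by have := tc k I; rewrite ks.
rewrite (_ : [set t | _] = \bigcup_s F s).
  apply: countable_bigcupT_measurable; first exact: countableP.
  by move=> s; rewrite /F; case: asboolP.
apply/seteqP; split=> t; last first.
  by move=> [s _]; rewrite /F; case: asboolP => // sU /sU.
move=> Ut; have /nbhs_ballP[e /= e0 eU] := open_nbhs_nbhs (conj oU Ut).
have [n na] := ball_prefix (g t) e0.
exists (mkseq (g t) n) => //; rewrite /F.
case: asboolP => [_|[]].
  by move=> k; rewrite size_mkseq => kn; rewrite nth_mkseq.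
move=> b bc; apply/eU/na => k kn; rewrite bc ?size_mkseq// nth_mkseq//.
Qed.

End words.

(** * The random embedding into words *)

Section uniform_unit.
Context (R : realType).

Definition unit_prob : probability (measurableTypeR R) R :=
  uniform_prob (@ltr01 R).

Lemma unit_prob_le (A : set (measurableTypeR R)) (a b : R) : measurable A ->
  (forall t, A t -> 0 <= t <= 1 -> a <= t <= b) -> a <= b ->
  (unit_prob A <= (b - a)%:E)%E.
Proof.
move=> mA Aab ab.
rewrite /unit_prob/= /uniform_prob integral_uniform_pdf.
have mA1 : measurable (A `&` `[0, 1]%classic) by exact: measurableI.
apply: (@le_trans _ _
    (\int[@lebesgue_measure R]_(x in A `&` `[0%R, 1%R]%classic) 1%:E)%E).
  apply: ge0_le_integral => //=.
  - by move=> x _; rewrite lee_fin uniform_pdf_ge0.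
  - by apply/measurable_EFinP/measurable_funTS; exact: measurable_uniform_pdf.
  - by move=> x _; rewrite /uniform_pdf subr0 invr1; case: ifP; rewrite ?lee_fin.
rewrite integral_cst//= mul1e.
apply: (@le_trans _ _ (lebesgue_measure (`[a, b]%classic : set R))).
  apply: le_measure; rewrite ?inE//= => t [At]; rewrite /= !in_itv/=.
  exact: Aab.
rewrite lebesgue_measure_itv/= lte_fin; case: ifP => _ //.
by rewrite lee_fin subr_ge0.
Qed.

End uniform_unit.

(** The integral of a nonnegative function is a supremum over the simple
    functions below it. *)
Lemma ge0_le_integral_majorant d (T : measurableType d) (R : realType)
    (mu : {measure set T -> \bar R}) (f g : T -> \bar R) :
  (forall x, 0 <= f x)%E -> (forall x, f x <= g x)%E ->
  (\int[mu]_x f x <= \int[mu]_x g x)%E.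
Proof.
move=> f0 fg; have g0 x : (0 <= g x)%E by exact: le_trans (fg x).
rewrite !ge0_integralTE//; apply: ereal_sup_le => _ [h /= hf <-].
by exists h => //= x; exact: le_trans (hf x) (fg x).
Qed.

Section random_words.
Context {R : realType} (X : metricType R) (w : distortion R) (q : X).
Variables (n : nat) (w0 K : R) (psi : nat -> nat -> X -> R).
Variables (z : nat -> nat -> X) (rad lip : nat -> R).
Hypothesis ms : multiscale w n w0 K psi z rad lip.

Local Notation Omega := (measurableTypeR R).
Local Notation P := (unit_prob R).
Implicit Types (k i : nat) (t : Omega) (x y : X).

Let fam k := ms_family ms k.

(** The disjunct [psi k i x == 1] makes some index admissible for every real [t],
    so that no exceptional set of thresholds has to be removed. *)
Definition above k t x i : bool :=
  (psi k i x != 0) && ((t <= psi k i x) || (psi k i x == 1)).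

Lemma above_one k t x i : psi k i x = 1 -> above k t x i.
Proof. by move=> p1; rewrite /above p1 oner_eq0 eqxx orbT. Qed.

Lemma exists_above k t x : exists i, above k t x i.
Proof. by have [i /above_one] := bump_cover (fam k) x; exists i. Qed.

Definition label k t x : nat := ex_minn (exists_above k t x).

Lemma label_above k t x : above k t x (label k t x).
Proof. by rewrite /label; case: ex_minnP. Qed.

Lemma label_le k t x i : above k t x i -> (label k t x <= i)%N.
Proof. by rewrite /label; case: ex_minnP => m _ mP /mP. Qed.

Lemma label_eq k t x i : (label k t x = i) <->
  above k t x i /\ forall j, (j < i)%N -> ~~ above k t x j.
Proof.
split=> [<-|[ai aj]].
  split; first exact: label_above.
  by move=> j; rewrite ltnNge; apply: contra => /label_le.
apply/eqP; rewrite eqn_leq label_le//= leqNgt; apply/negP => /aj.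
by rewrite label_above.
Qed.

(** The letters are recoded relative to the labels of the basepoint, whose image
    thus becomes constant. *)
Definition random_word t x : words :=
  fun k => if label k t x == label k t q then 0%N else (label k t x).+1.

Lemma random_word_base t : random_word t q = (fun=> 0%N).
Proof. by apply/funext => k; rewrite /random_word eqxx. Qed.

Lemma random_word_neq t x y k :
  (random_word t x k != random_word t y k) = (label k t x != label k t y).
Proof.
rewrite /random_word; move: (label k t x) (label k t y) (label k t q) => a b c.
have [->|ac] := eqVneq a c; first by case: (eqVneq b c).
by have [->|bc] := eqVneq b c => //=; rewrite ac.
Qed.

Lemma measurable_above k x i : measurable [set t | above k t x i].
Proof.
rewrite /above; case: (psi k i x != 0) => /=; last first.
  by rewrite (_ : [set t | _] = set0)// -subset0.
case: (psi k i x == 1).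
  rewrite (_ : [set t | _] = setT)//; apply/seteqP; split=> // t _ /=.
  by rewrite orbT.
rewrite (_ : [set t | _] = `]-oo, psi k i x]%classic).
  exact: measurable_itv.
by apply/seteqP; split=> t /=; rewrite in_itv/= orbF.
Qed.

Lemma measurable_label k x i : measurable [set t | label k t x = i].
Proof.
rewrite (_ : [set t | _] = [set t | above k t x i] `&`
  \bigcap_j (if (j < i)%N then ~` [set t | above k t x j] else setT)).
  apply: measurableI; first exact: measurable_above.
  apply: bigcapT_measurable => j; case: ifP => // _.
  by apply: measurableC; exact: measurable_above.
apply/seteqP; split=> t /=.
  move=> /label_eq[ai aj]; split=> // j _; case: ifP => // /aj.
  by move=> /negP.
move=> [ai aj]; apply/label_eq; split=> // j ji.
by have := aj j I; rewrite ji => /negP.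
Qed.

Lemma measurable_label2 k x y (B : nat -> nat -> bool) :
  measurable [set t | B (label k t x) (label k t y)].
Proof.
rewrite (_ : [set t | _] = \bigcup_i \bigcup_j (if B i j then
  [set t | label k t x = i] `&` [set t | label k t y = j] else set0)).
  apply: bigcupT_measurable => i; apply: bigcupT_measurable => j.
  by case: ifP => // _; apply: measurableI; exact: measurable_label.
apply/seteqP; split=> t /=.
  by move=> Bt; exists (label k t x) => //; exists (label k t y) => //; rewrite Bt.
by move=> [i _ [j _]]; case: ifP => // Bij [/= -> ->].
Qed.

Lemma random_word_random_map :
  @random_map R (distorted w X) words _ Omega P q (fun=> 0%N) random_word.
Proof.
split=> [x B|x|].
- apply: (@words_open_measurable R _ Omega) => k c.
  pose recode i j := (if i == j then 0%N else i.+1) == c.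
  rewrite (_ : [set t | _] = [set t | recode (label k t x) (label k t q)]).
    exact: measurable_label2.
  by apply/seteqP; split=> t /= /eqP.
- exists setT; first exact: words_separable.
  exact: aeW.
- by apply: aeW => t; exact: random_word_base.
Qed.

(** Both points lie in the support of the bump designated by their common
    label. *)
Lemma label_eq_dist k t x y : label k t x = label k t y ->
  w (mdist x y) <= 2 * K * (w0 / 2 ^+ k).
Proof.
move=> lxy.
have near u : psi k (label k t u) u != 0 by have /andP[] := label_above k t u.
have dx := bump_rad (fam k) (near x); have dy := bump_rad (fam k) (near y).
rewrite -lxy in dy.
have rad0 : 0 <= rad k by exact: le_trans (mdist_ge0 _ _) dx.
have dxy : mdist x y <= 2 * rad k.
  have := metric_triangle x (z k (label k t x)) y.
  rewrite (metric_sym (z k _) y); lra.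
apply: (le_trans (distortion_nondecreasing w (mdist_ge0 _ _) dxy)).
apply: (le_trans (distortion_dilation w _ rad0)); first by rewrite ler1n.
by rewrite -mulrA ler_wpM2l//; exact: (ms_rad ms).
Qed.

(** At the level preceding the first difference the labels agree; that level
    exists because all labels of level [0] are equal. *)
Lemma random_word_lower t x y :
  w (mdist x y) <= 4 * K * w0 * word_dist R (random_word t x) (random_word t y).
Proof.
have w00 := ms_w0 ms; have K0 := ms_K ms.
have [[k kP]|same] := pselect (exists k, label k t x != label k t y).
  have [m mP mmin] :=
    ex_minnP (ex_intro (fun k => label k t x != label k t y) k kP).
  have m0 : (0 < m)%N.
    rewrite lt0n; apply: contra mP => /eqP ->; apply/eqP.
    have l0 u : label 0 t u = 0%N.
      by apply/eqP; rewrite -leqn0 label_le// above_one// (ms_level0 ms).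
    by rewrite !l0.
  have : label m.-1 t x = label m.-1 t y.
    apply/eqP; apply: contrapT => /negP /mmin.
    by rewrite leqNgt ltn_predL m0.
  move=> /label_eq_dist le; apply: (le_trans le).
  have := @word_dist_ge R (random_word t x) (random_word t y) m.
  rewrite random_word_neq => /(_ mP) ge.
  have E : 2 * K * (w0 / 2 ^+ m.-1) = 4 * K * w0 * (2 ^+ m)^-1.
    rewrite -{2}(prednK m0) exprS; field; rewrite expf_neq0//.
  by rewrite E ler_wpM2l// !mulr_ge0// ltW.
have same' k : label k t x = label k t y.
  by apply/eqP; apply: contrapT => /negP h; apply: same; exists k.
have : w (mdist x y) <= 0.
  apply/ler_addgt0Pl => e e0; rewrite addr0.
  have h2 : `|2^-1 : R| < 1 by rewrite ger0_norm ?invr_ge0// invf_lt1// ltr1n.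
  have /cvgrPdist_le /(_ e e0) [k _ /(_ k (leqnn k))] :=
    cvg_geometric (2 * K * w0) h2.
  rewrite /geometric/= sub0r normrN exprVn ger0_norm; last first.
    by rewrite divr_ge0 ?exprn_ge0// !mulr_ge0// ltW.
  move=> le; apply: le_trans le; rewrite -[leRHS]mulrA.
  exact: label_eq_dist (same' k).
by move=> h; rewrite (le_trans h)// !mulr_ge0 ?word_dist_ge0// ltW.
Qed.

(** The labels differ only if the threshold separates the values of some bump
    at the two points, and few bumps are nonzero there. *)
Lemma prob_label_neq_le k x y :
  (P [set t | label k t x != label k t y] <=
   (2 * n.+1%:R * Num.min 1 (lip k * mdist x y))%:E)%E.
Proof.
have mS : measurable [set t | label k t x != label k t y].
  exact: (measurable_label2 k x y (fun i j => i != j)).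
have n1 : 1 <= n.+1%:R :> R by rewrite ler1n.
rewrite /Num.min; case: ifP => _.
  rewrite mulr1; apply: (@le_trans _ _ 1%:E); first exact: probability_le1.
  rewrite lee_fin; lra.
have [ix px] := bump_cover (fam k) x; have [iy py] := bump_cover (fam k) y.
pose I := maxn ix.+1 iy.+1.
pose S i := [set t | above k t x i != above k t y i].
have mSi i : measurable (S i).
  rewrite (_ : S i = ([set t | above k t x i] `\` [set t | above k t y i]) `|`
    ([set t | above k t y i] `\` [set t | above k t x i])).
    by apply: measurableU; apply: measurableD; exact: measurable_above.
  apply/seteqP; split=> t; rewrite /S /=.
    by case: (above k t x i); case: (above k t y i) => // _; [left|right].
  by move=> [[-> /negP/negPf ->]|[-> /negP/negPf ->]].
have sub : [set t | label k t x != label k t y] `<=` \big[setU/set0]_(i < I) S i.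
  move=> t /= lxy; rewrite -bigcup_mkord.
  apply: contrapT => no; move/negP: lxy; apply; apply/eqP.
  have agree i : (i < I)%N -> above k t x i = above k t y i.
    by move=> iI; apply/eqP; apply: contrapT => /negP h; apply: no; exists i.
  have lx : (label k t x < I)%N.
    by rewrite /I leq_max ltnS label_le// above_one.
  have ly : (label k t y < I)%N.
    by rewrite /I leq_max !ltnS (label_le (i := iy)) ?orbT// above_one.
  apply/eqP; rewrite eqn_leq !label_le//.
    by rewrite -agree ?label_above.
  by rewrite agree ?label_above.
apply: (le_trans (content_subadditive P (fun i _ => mSi i) mS sub)).
have Si i : (P (S i) <= `|psi k i x - psi k i y|%:E)%E.
  have half u v t : 0 <= t <= 1 -> above k t u i -> ~~ above k t v i ->
      psi k i v <= t <= psi k i u.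
    move=> /andP[t0 t1] /andP[_ au]; rewrite negb_and negbK negb_or -ltNge.
    move=> av; apply/andP; split.
      by case/orP: av => [/eqP ->|/andP[/ltW]].
    by case/orP: au => // /eqP ->.
  have [le|le] := leP (psi k i y) (psi k i x).
    rewrite ger0_norm ?subr_ge0//; apply: unit_prob_le => // t.
    rewrite /S /=; case ax : (above k t x i); case ay : (above k t y i) => //= _ t01.
      by apply: half => //; rewrite ay.
    have /andP[yt tx] := half y x t t01 ay (negbT ax).
    by apply/andP; split; lra.
  rewrite distrC ger0_norm ?subr_ge0 ?(ltW le)//; apply: unit_prob_le => // [t|];
    last exact: ltW.
  rewrite /S /=; case ax : (above k t x i); case ay : (above k t y i) => //= _ t01.
    have /andP[yt tx] := half x y t t01 ax (negbT ay).
    by apply/andP; split; lra.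
  by apply: half => //; rewrite ax.
apply: (@le_trans _ _ (\sum_(i < I) `|psi k i x - psi k i y|)%:E).
  by rewrite -sumEFin; apply: lee_sum => i _; exact: Si.
rewrite lee_fin; apply: sum_lipschitz_multiplicity.
  exact: (bump_lip (fam k)).
exact: (bump_mult (fam k)).
Qed.

Lemma expected_word_dist_le x y :
  ('E_P[fun t => word_dist R (random_word t x) (random_word t y)] <=
   (2 * n.+1%:R * K / w0 * w (mdist x y))%:E)%E.
Proof.
have w00 := ms_w0 ms.
rewrite unlock; set B : R := 2 * n.+1%:R * K / w0 * w (mdist x y).
pose S k := [set t | label k t x != label k t y].
have mS k : measurable (S k).
  exact: (measurable_label2 k x y (fun i j => i != j)).
(* truncating the word at level N costs at most 2^-N *)
have trunc N t : word_dist R (random_word t x) (random_word t y) <=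
    \sum_(k < N) (2 ^+ k)^-1 * \1_(S k) t + (2 ^+ N)^-1.
  have pos k : 0 <= (2 ^+ k)^-1 * \1_(S k) t :> R.
    by rewrite mulr_ge0// invr_ge0 exprn_ge0.
  apply: word_dist_le => [|k].
    by rewrite addr_ge0 ?sumr_ge0// invr_ge0 exprn_ge0.
  rewrite random_word_neq => lk; have [kN|Nk] := ltnP k N; last first.
    apply: (@le_trans _ _ (2 ^+ N)^-1); last by rewrite lerDr sumr_ge0.
    by rewrite lef_pV2 ?posrE ?exprn_gt0// ler_weXn2l ?ler1n.
  rewrite (bigD1 (Ordinal kN))//= -addrA.
  apply: (@le_trans _ _ ((2 ^+ k)^-1 * \1_(S k) t)).
    by rewrite indicE mem_set// mulr1.
  by rewrite lerDl addr_ge0 ?sumr_ge0// invr_ge0 exprn_ge0.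
have bound N : (\int[P]_t (word_dist R (random_word t x) (random_word t y))%:E <=
    (B + (2 ^+ N)^-1)%:E)%E.
  apply: (@le_trans _ _ (\int[P]_t (\sum_(k < N) (2 ^+ k)^-1%:E * (\1_(S k) t)%:E
      + (2 ^+ N)^-1%:E))%E).
    apply: ge0_le_integral_majorant => t; first by rewrite lee_fin word_dist_ge0.
    apply: (@le_trans _ _ (\sum_(k < N) (2 ^+ k)^-1 * \1_(S k) t + (2 ^+ N)^-1)%:E).
      by rewrite lee_fin.
    by rewrite EFinD -sumEFin.
  have mind k : measurable_fun [set: Omega] (fun t => (\1_(S k) t)%:E : \bar R).
    exact/measurable_EFinP/measurable_indic.
  have c0 k : (0 <= (2 ^+ k)^-1%:E :> \bar R)%E.
    by rewrite lee_fin invr_ge0 exprn_ge0.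
  have ind0 k t : (0 <= (\1_(S k) t)%:E :> \bar R)%E by rewrite lee_fin.
  have mterm k : measurable_fun [set: Omega]
      (fun t => (2 ^+ k)^-1%:E * (\1_(S k) t)%:E : \bar R)%E.
    exact: measurable_funeM.
  rewrite ge0_integralD//; last 2 first.
  - by move=> t _; apply: sume_ge0 => k _; rewrite mule_ge0.
  - by apply: emeasurable_sum => k.
  rewrite (ge0_integral_sum P measurableT
    (f := fun (k : 'I_N) t => (2 ^+ k)^-1%:E * (\1_(S k) t)%:E)%E)//.
  rewrite integral_cst// EFinD; apply: leeD; last first.
    have PT : P [set: Omega] = 1%E by exact: probability_setT.
    by rewrite -[leRHS]mule1 -PT.
  apply: (@le_trans _ _ (\sum_(k < N) ((2 ^+ k)^-1 *
      (2 * n.+1%:R * Num.min 1 (lip k * mdist x y)))%:E)%E).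
    apply: lee_sum => k _; rewrite ge0_integralZl// integral_indic// setIT.
    by rewrite EFinM lee_pmul2l// ?lte_fin ?invr_gt0 ?exprn_gt0// prob_label_neq_le.
  rewrite sumEFin lee_fin /B.
  rewrite (_ : \sum_(k < N) _ = 2 * n.+1%:R / w0 *
      \sum_(k < N) w0 / 2 ^+ k * Num.min 1 (lip k * mdist x y)); last first.
    rewrite mulr_sumr; apply: eq_bigr => k _.
    have z0 : (2 : R) ^+ k != 0 by rewrite expf_neq0.
    by field; rewrite z0 gt_eqF.
  rewrite (_ : 2 * n.+1%:R * K / w0 * w (mdist x y) =
    2 * n.+1%:R / w0 * (K * w (mdist x y))); last by ring.
  rewrite ler_wpM2l ?divr_ge0 ?mulr_ge0 ?(ltW w00)//.
  exact: (ms_sum ms).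
apply/lee_addgt0Pr => e e0.
have h2 : `|2^-1 : R| < 1 by rewrite ger0_norm ?invr_ge0// invf_lt1// ltr1n.
have /cvgrPdist_le /(_ e e0) [N _ /(_ N (leqnn N))] := cvg_geometric 1 h2.
rewrite /geometric/= sub0r normrN exprVn mul1r ger0_norm; last first.
  by rewrite invr_ge0 exprn_ge0.
move=> Ne; apply: (le_trans (bound N)).
by rewrite -EFinD lee_fin lerD2l.
Qed.

Theorem random_word_stoch_bilipschitz :
  exists D s, 0 < s /\
    @stoch_bilipschitz R (distorted w X) words _ Omega P random_word D s.
Proof.
have w00 := ms_w0 ms; have K0 := ms_K ms.
pose s := (4 * (K + 1) * w0)^-1.
have s0 : 0 < s by rewrite invr_gt0 !mulr_gt0// ltr_wpDl.
exists (2 * n.+1%:R * K / w0 / s), s; split=> //; split=> x y.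
  have := expected_word_dist_le x y.
  by rewrite mulrCA divff ?gt_eqF// mulr1.
apply: aeW => t; rewrite mdist_distorted mdist_words /s mulrC ler_pdivrMr; last first.
  by rewrite !mulr_gt0// ltr_wpDl.
apply: (le_trans (random_word_lower t x y)); rewrite mulrC.
rewrite ler_wpM2l ?word_dist_ge0// ler_wpM2r ?(ltW w00)// ler_wpM2l// lerDl.
exact: ler01.
Qed.

End random_words.

(** * Distortions of bounded spaces of finite Nagata dimension *)

Theorem theorem4p21 (R : realType) (p : R) (p_gt1 : 1 < p)
    (w : distortion R) (w_concave : p_concave p w)
    (X : metricType R) (q : X)
    (X_bounded : bounded_space X) (X_separable : separable_set [set: X])
    (X_nagata : finite_nagata_dim X) :
  (exists (D : R) (Y : metricType R) (y0 : Y),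
    [/\ bounded_space Y, separable_set [set: Y], ultrametric Y
      & @stoch_embeds R (distorted w X) Y q y0 D])
  /\
  (infinite_set [set: X] ->
   compact [set: X] \/ complemented_in_bidual (@LF R (distorted w X) q) ->
   isomorphic (@LF R (distorted w X) q) (ell1 R)).
Proof.
have [n [w0 [K [psi [z [rad [lip ms]]]]]]] :=
  multiscale_exists q p_gt1 w_concave X_bounded X_separable X_nagata.
split.
  have [D [s [s0 bilip]]] := random_word_stoch_bilipschitz q ms.
  exists D, (words : metricType R), (fun=> 0%N); split.
  - exact: words_bounded.
  - exact: words_separable.
  - exact: words_ultrametric.
  - exists _, (measurableTypeR R), (unit_prob R), (random_word q ms).
    by split; [exact: random_word_random_map|exists s].
move=> X_infinite _.
have [A [B [blA blB BA]]] := free_space_factorization q ms.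
have [Delta _ dX] := bounded_space_mdist X_bounded.
have dY (x y : distorted w X) : mdist x y <= w Delta.
  rewrite mdist_distorted; apply: distortion_nondecreasing; last exact: dX.
  exact: mdist_ge0.
have [x [y [r [K' bumps]]]] :=
  @bump_sequence_exists R (distorted w X) q _ dY X_infinite.
have [a [b [bla blb ba]]] :=
  @bump_sequence_complemented R (distorted w X) q _ _ _ _ bumps.
exact: complemented_ell1_isomorphic blA blB bla blb BA ba.
Qed.
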